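(* Consider the generalized Pólya urn with $A\ge2$ agents constructed via the exponential embedding. Assume that at least two of the feedback functions satisfy $\sum_{k=1}^\infty 1/F_j(k)<\infty$, and let $i\in[A]$ be one of them. Then as $x\to\infty$, $$\mathbb{P}(X_i(\infty)=x)\sim\frac{\mathbb{E}\, g_i\big(\min_{j\ne i}T_j\big)}{F_i(x)}\qquad\text{and}\qquad \mathbb{P}(X_i(\infty)>x\mid sMon_i^c)\sim\frac{\mathbb{E}\, g_i\big(\min_{j\ne i}T_j\big)}{\mathbb{P}\big(T_i>\min_{j\ne i}T_j\big)}\sum_{k=x+1}^\infty\frac{1}{F_i(k)}.$$
   Context: $\mathbb{N}=\{1,2,\dots\}$, $[A]=\{1,\dots,A\}$, $e^{(i)}$ the $i$-th unit vector of $\mathbb{R}^A$. For each $i\in[A]$ let $F_i\colon\mathbb{N}\to(0,\infty)$ (feedback function) and $X_i(0)\in\mathbb{N}$. Let $\Xi_1,\dots,\Xi_A$ be independent pure birth processes: $\Xi_i$ has independent sojourn times $\tau_i(k)$, $k\ge X_i(0)$, exponential with rate $F_i(k)$, and $\Xi_i(t)=\min\{k:\sum_{l=X_i(0)}^k\tau_i(l)>t\}$ (min of empty set $=\infty$). Its explosion time is $T_i=\sum_{k\ge X_i(0)}\tau_i(k)\in(0,\infty]$; if $\sum_k1/F_i(k)<\infty$ then $T_i<\infty$ a.s. and $g_i$ denotes its density. With $\Xi=(\Xi_1,\dots,\Xi_A)$, $t_0=0$, $t_{n+1}=\inf\{t>t_n:\Xi(t)\ne\Xi(t_n)\}$, set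 $X(n)=\Xi(t_n)$; this is the generalized Pólya urn, a Markov chain on $\mathbb{N}^A$ with $\mathbb{P}(X(n+1)-X(n)=e^{(i)}\mid X(n))=F_i(X_i(n))/\sum_{j}F_j(X_j(n))$. $\mathbb{P}$ denotes the law of the independent birth processes. $X_i(\infty)=\lim_{n\to\infty}X_i(n)$, and $sMon_i=\{\exists N\ \forall n\ge N\ \forall j\ne i: X_j(n)=X_j(N)\}$ is the event that agent $i$ is the strong monopolist. $x_k\sim y_k$ means $x_k/y_k\to1$. *)

(* Defs.v *)
From HB Require Import structures.
From mathcomp Require Import all_boot all_order all_algebra.
From mathcomp Require Import all_classical all_reals all_analysis.
From mathcomp Require Import exponential_distribution.

Set Implicit Arguments.
Unset Strict Implicit.
Unset Printing Implicit Defensive.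

Import Order.TTheory GRing.Theory Num.Theory.
Import numFieldNormedType.Exports.

Local Open Scope classical_set_scope.
Local Open Scope ring_scope.

Section Defs.
Context {R : realType} {d : measure_display} {Omega : measurableType d}.

Definition mutually_independent {I : eqType} (P : probability Omega R)
  (Idx : I -> Prop) (X : I -> Omega -> R) : Prop :=
  forall (J : seq I) (B : I -> set R),
    uniq J -> (forall j, j \in J -> Idx j) ->
    (forall j, measurable (B j)) ->
    P (\big[setI/setT]_(j <- J) (X j @^-1` B j)) =
    (\prod_(j <- J) P (X j @^-1` B j))%E.

Definition is_density (P : probability Omega R) (Y : Omega -> \bar R)
  (g : R -> R) : Prop :=
  measurable_fun setT g /\ (forall x, 0 <= g x) /\
  forall t : R, P [set w | (Y w <= t%:E)%E] =
    (\int[lebesgue_measure]_(x in `]-oo, t]) (g x)%:E)%E.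

Definition asymp_equiv (u v : nat -> R) : Prop :=
  (fun k => u k / v k) @ \oo --> (1 : R).

Variable A : nat.
Variable X0 : 'I_A -> nat.
Variable tau : 'I_A -> nat -> Omega -> R.

Definition partial_time (i : 'I_A) (k : nat) (w : Omega) : R :=
  \sum_(X0 i <= l < k.+1) tau i l w.

Definition explosion_time (i : 'I_A) (w : Omega) : \bar R :=
  (\sum_(X0 i <= k <oo) (tau i k w)%:E)%E.

Definition birth_proc (i : 'I_A) (t : R) (w : Omega) : \bar R :=
  match pselect (exists k, (fun k => (X0 i <= k)%N && `[< t < partial_time i k w >]) k)
  with
  | left e => ((ex_minn e)%:R)%:E
  | right _ => +oo%E
  end.

Definition birth_proc_e (i : 'I_A) (t : \bar R) (w : Omega) : \bar R :=
  match t with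
  | r%:E => birth_proc i r w
  | _ => +oo%E
  end.

Fixpoint jump_time (n : nat) (w : Omega) : \bar R :=
  match n with
  | 0 => 0%E
  | n.+1 =>
    ereal_inf [set t%:E | t in [set t : R |
       (jump_time n w < t%:E)%E /\
       (fun j => birth_proc j t w) <> (fun j => birth_proc_e j (jump_time n w) w)]]
  end.

Definition urn (i : 'I_A) (n : nat) (w : Omega) : \bar R :=
  birth_proc_e i (jump_time n w) w.

Definition urn_limit (i : 'I_A) (w : Omega) : \bar R :=
  limn (fun n => urn i n w).

Definition strong_monopoly (i : 'I_A) : set Omega :=
  [set w | exists N, forall n, (N <= n)%N -> forall j, j != i ->
     urn j n w = urn j N w].

Definition min_other_explosion (i : 'I_A) (w : Omega) : \bar R :=
  (\big[Order.min/+oo]_(j | j != i) explosion_time j w)%E.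

End Defs.

(* Main.v *)
(* Let M be the minimum of the explosion times of the agents j <> i, and S_x the time at
   which Xi_i leaves x. The urn stops at the first explosion, so almost surely
   {X_i(oo) > x} = {S_x < M} and sMon_i^c = {M <= T_i}. Put a = F_i(X_i(0)) and
   b = F_i(x), and let Y be M minus the sojourn times of Xi_i strictly between X_i(0)
   and x. Then {X_i(oo) = x} = {tau < Y <= tau + tau'}, where tau and tau', the sojourn
   times at X_i(0) and at x, are exponential of rates a and b, independent of each other
   and of Y, so that
     b P(X_i(oo) = x) = E[1(Y > 0) a b (e^(-aY) - e^(-bY)) / (b - a)].
   As x -> oo, b tends to oo and Y to M - R, with R = T_i - tau. By dominated
   convergence the right-hand side tends to E f_a(M - R), where f_a is the density of
   tau. Since t |-> E f_a(t - R) is a version of g_i and M is absolutely continuous and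
   independent of R, this limit is E g_i(M). It is positive because R < n <= M with
   positive probability for some n. The tail asymptotics follow by summing
   P(X_i(oo) = k) over k > x. *)
Require Import Defs.
From HB Require Import structures.
From mathcomp Require Import all_boot all_order all_algebra.
From mathcomp Require Import all_classical all_reals all_analysis.
From mathcomp Require Import exponential_distribution measurable_realfun.
From mathcomp Require Import ring lra.

Import Order.TTheory GRing.Theory Num.Theory.
Import numFieldNormedType.Exports.
Local Open Scope classical_set_scope.
Local Open Scope ring_scope.

Set Implicit Arguments.
Unset Strict Implicit.
Unset Printing Implicit Defensive.

(** * Trajectories of the urn *)

(** The density [g] is given only through its integrals over rays, so its value at a point carries
    no information and no continuity is at hand. This is why one sojourn time of agent i is split
    off: its density is explicit and bounded, and integrating it out turns both the probability and
    the constant into expectations of explicit functions of the remaining variables. The price is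
    that this density jumps at 0, so pointwise convergence may fail on {M = R}; this event is null
    because R still contains an independent exponential summand. For large x the rate b exceeds 2 a,
    which both avoids the singular case b = a and gives the dominating constant 2 a. A tie M = T_i
    counts as non-monopoly and would survive every level x, so ties have to be excluded almost
    surely before the tail can be summed. The pathwise identities hold only where all sojourn times
    are positive. They pass to probabilities through almost sure equivalence of events, which
    requires jump times, urn limit and monopoly events to be measurable. *)

Section natbar.
Context {R : realType}.
Implicit Types x y : \bar R.

(** The extended naturals, in which the processes and their limits take values. Such a value is
    determined by the naturals below it, and paths are compared through these thresholds. *)
Definition natbar x := x = +oo%E \/ exists k : nat, x = k%:R%:E.

Lemma le_natbar x y : natbar x ->
  (forall n : nat, (n%:R%:E <= x)%E -> (n%:R%:E <= y)%E) -> (x <= y)%E.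
Proof.
move=> [->|[k ->]] xy; last exact: xy.
rewrite leye_eq; case: y xy => [r| |] xy //.
- have := xy (Num.truncn r).+1 (leey _).
  by rewrite lee_fin leNgt truncnS_gt.
- by have := xy 0 (leey _).
Qed.

Lemma natbar_lt x y : natbar x -> (x < y)%E -> exists k : nat, x = k%:R%:E.
Proof. by move=> [->|//]; rewrite ltNge leey. Qed.

Lemma natbar_ltE x (n : nat) : natbar x -> (n%:R%:E < x)%E = (n.+1%:R%:E <= x)%E.
Proof.
move=> [->|[k ->]]; first by rewrite leey ltry.
by rewrite lte_fin lee_fin ltr_nat ler_nat.
Qed.

(** A largest attained value exists below [K], and monotonicity freezes the sequence from an index
    that attains it. *)
Lemma natbar_stationary (u : nat -> \bar R) (K : nat) :
  (forall n, natbar (u n)) -> {homo u : m n / (m <= n)%N >-> (m <= n)%E} ->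
  (forall n, (u n <= K%:R%:E)%E) ->
  exists N, forall n, (N <= n)%N -> u n = u N.
Proof.
move=> un um uK.
pose p k := `[< exists n, u n = k%:R%:E >].
have exp : exists k, p k.
  have [k uk] := natbar_lt (un 0) (le_lt_trans (uK 0) (ltry _)).
  by exists k; apply/asboolP; exists 0.
have ubp k : p k -> (k <= K)%N.
  by move=> /asboolP[n unk]; have := uK n; rewrite unk lee_fin ler_nat.
case: (ex_maxnP exp ubp) => k /asboolP[N uN] kmax.
exists N => n Nn; rewrite uN; apply/eqP; rewrite eq_le -{2}uN um// andbT.
have [l ul] := natbar_lt (un n) (le_lt_trans (uK n) (ltry _)).
by rewrite ul lee_fin ler_nat kmax//; apply/asboolP; exists n.
Qed.

End natbar.

Section paths.
Context {R : realType} {d : measure_display} {Omega : measurableType d}.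
Variables (A : nat) (X0 : 'I_A -> nat) (tau : 'I_A -> nat -> Omega -> R).
Implicit Types (j : 'I_A) (w : Omega) (t : R).

Local Notation S := (partial_time X0 tau).
Local Notation T := (explosion_time X0 tau).
Local Notation Xi := (birth_proc X0 tau).
Local Notation Xie := (birth_proc_e X0 tau).
Local Notation J := (jump_time X0 tau).
Local Notation X := (urn X0 tau).

Lemma birth_proc_natbar j t w : natbar (Xi j t w).
Proof.
rewrite /birth_proc; case: pselect => [e|_]; last by left.
by right; exists (ex_minn e).
Qed.

(** The working form of the definition, valid before and after explosion alike; it replaces
    [ex_minn] from here on. All [l < n] are tested because partial sums are not yet known to
    increase. *)
Lemma le_birth_proc j t w (n : nat) : (n%:R%:E <= Xi j t w)%E <->
  (forall l, (X0 j <= l < n)%N -> S j l w <= t).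
Proof.
rewrite /birth_proc; case: pselect => [e|ne]; last first.
  split; last by rewrite leey.
  move=> _ l /andP[Xl _]; rewrite leNgt; apply/negP => tl.
  by apply: ne; exists l; rewrite Xl; apply/asboolP.
case: ex_minnP => k /andP[Xk /asboolP tk] kmin.
rewrite lee_fin ler_nat; split=> [nk l /andP[Xl ln]|h].
  rewrite leNgt; apply/negP => tl; have : (k <= l)%N.
    by apply: kmin; rewrite Xl; apply/asboolP.
  by rewrite leqNgt (leq_trans ln nk).
by rewrite leqNgt; apply/negP => kn; move: tk; rewrite ltNge h// Xk.
Qed.

Lemma birth_proc_homo j w : {homo Xi j ^~ w : s t / s <= t >-> (s <= t)%E}.
Proof.
move=> s t st; apply: le_natbar; first exact: birth_proc_natbar.
move=> n /le_birth_proc h; apply/le_birth_proc => l /h.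
by move=> /le_trans; apply.
Qed.

Lemma birth_proc_right j t w k : Xi j t w = k%:R%:E -> t < S j k w.
Proof.
move=> e; rewrite ltNge; apply/negP => Sk.
have : (k.+1%:R%:E <= Xi j t w)%E.
  apply/le_birth_proc => l /andP[Xl]; rewrite ltnS leq_eqVlt => /predU1P[->//|lk].
  suff /le_birth_proc : (k%:R%:E <= Xi j t w)%E by apply; rewrite Xl.
  by rewrite e.
by rewrite e lee_fin ler_nat ltnn.
Qed.

Lemma birth_proc_e_natbar j (t : \bar R) w : natbar (Xie j t w).
Proof. by case: t => [r| |]; [exact: birth_proc_natbar|left|left]. Qed.

(** The sign condition discards [-oo], where [birth_proc_e] has the default value [+oo]; jump times
    satisfy it. *)
Lemma le_birth_proc_e j (t : \bar R) w (n : nat) : (0 <= t)%E ->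
  (n%:R%:E <= Xie j t w)%E <->
  (forall l, (X0 j <= l < n)%N -> ((S j l w)%:E <= t)%E).
Proof.
case: t => [r _|_|//] /=; first exact: le_birth_proc.
by rewrite leey; split => // _ l _; rewrite leey.
Qed.

Lemma jump_timeS_ge n w : (J n w <= J n.+1 w)%E.
Proof. by apply: le_ereal_inf_tmp => _ [t [Jt _] <-]; exact: ltW. Qed.

Lemma jump_time_homo w : {homo J ^~ w : m n / (m <= n)%N >-> (m <= n)%E}.
Proof. by apply: homo_leq => // [x y z|n]; [exact: le_trans|exact: jump_timeS_ge]. Qed.

Lemma jump_time_ge0 n w : (0 <= J n w)%E.
Proof. by have := jump_time_homo w (leq0n n). Qed.

Lemma le_urn j n w (k : nat) : (k%:R%:E <= X j n w)%E <->
  (forall l, (X0 j <= l < k)%N -> ((S j l w)%:E <= J n w)%E).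
Proof. exact/le_birth_proc_e/jump_time_ge0. Qed.

Lemma urn_natbar j n w : natbar (X j n w).
Proof. exact: birth_proc_e_natbar. Qed.

Lemma urn_homo j w : {homo (X j) ^~ w : m n / (m <= n)%N >-> (m <= n)%E}.
Proof.
move=> m n mn; apply: le_natbar; first exact: urn_natbar.
move=> k /le_urn h; apply/le_urn => l /h /le_trans; apply.
exact: jump_time_homo.
Qed.

Lemma urn_le j n w k : (X0 j <= k)%N -> (J n w < (S j k w)%:E)%E ->
  (X j n w <= k%:R%:E)%E.
Proof.
move=> Xk tk; rewrite leNgt natbar_ltE; last exact: urn_natbar.
by apply/negP => /le_urn/(_ k); rewrite Xk ltnSn leNgt tk => /(_ isT).
Qed.

Lemma lt_urn_limit j w (x : nat) :
  (x%:R%:E < urn_limit X0 tau j w)%E <-> exists n, (x%:R%:E < X j n w)%E.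
Proof.
have /ereal_nondecreasing_cvgn/cvg_lim : nondecreasing_seq (X j ^~ w).
  exact: urn_homo.
rewrite /urn_limit => ->//; split.
  by move=> /ereal_sup_gt[_ [n _ <-]]; exists n.
by move=> [n /lt_le_trans]; apply; apply: ereal_sup_ubound; exists n.
Qed.

(** An unbounded path has limit [+oo], and a bounded one is stationary, so that its limit is one of
    its values. *)
Lemma urn_limit_natbar j w : natbar (urn_limit X0 tau j w).
Proof.
have /ereal_nondecreasing_cvgn/cvg_lim : nondecreasing_seq (X j ^~ w).
  exact: urn_homo.
rewrite /urn_limit => ->//.
set s := ereal_sup _; have [->|soo] := eqVneq s +oo%E; first by left.
have s0 : (0 <= s)%E.
  apply: (@le_trans _ _ (X j 0 w)); last by apply: ereal_sup_ubound; exists 0%N.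
  by have [->|[k ->]] := urn_natbar j 0 w; rewrite ?leey// lee_fin.
have [K sK] : exists K : nat, (s <= K%:R%:E)%E.
  case: s soo s0 => // r _; rewrite lee_fin => r0.
  by exists (Num.truncn r).+1; rewrite lee_fin ltW// truncnS_gt.
have uK n : (X j n w <= K%:R%:E)%E.
  by apply: le_trans sK; apply: ereal_sup_ubound; exists n.
have [N uN] := natbar_stationary (fun n => urn_natbar j n w) (urn_homo j w) uK.
suff -> : s = X j N w by exact: urn_natbar.
apply/eqP; rewrite eq_le; apply/andP; split; last first.
  by apply: ereal_sup_ubound; exists N.
apply: ge_ereal_sup => _ [n _ <-].
have [Nn|/ltnW nN] := leqP N n; first by rewrite uN.
exact: urn_homo.
Qed.

Section positive.
Variable w : Omega.
Hypothesis tau_gt0 : forall j k, (X0 j <= k)%N -> 0 < tau j k w.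

Lemma partial_timeS j k : (X0 j <= k.+1)%N ->
  S j k.+1 w = S j k w + tau j k.+1 w.
Proof. by move=> Xk; rewrite /partial_time big_nat_recr//= ltnW. Qed.

Lemma partial_time_homo j : {homo S j ^~ w : k l / (k <= l)%N >-> k <= l}.
Proof.
apply: homo_leq => // [x y z|k]; first exact: le_trans.
have [Xk|Xk] := leqP (X0 j) k.+1.
  by rewrite partial_timeS// lerDl ltW// tau_gt0.
by rewrite /partial_time !big_geq// ltnW.
Qed.

Lemma partial_time_lt j k l : (X0 j <= l)%N -> (k < l)%N -> S j k w < S j l w.
Proof.
case: l => // l Xl kl; rewrite partial_timeS//.
rewrite (le_lt_trans (partial_time_homo j (kl : (k <= l)%N)))//.
by rewrite ltrDl tau_gt0.
Qed.

Lemma explosion_time_sup j :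
  T j w = ereal_sup (range (fun k => (S j k w)%:E)).
Proof.
rewrite /explosion_time -(cvg_lim _ (ereal_nondecreasing_cvgn _))//; last first.
  by move=> k l kl; rewrite lee_fin partial_time_homo.
apply/esym/cvg_lim => //.
have -> : (fun k => (S j k w)%:E) = (fun k =>
   (fun n => \sum_(X0 j <= l < n) (tau j l w)%:E) k.+1)%E.
  by apply/funext => k; rewrite sumEFin.
rewrite (cvg_shiftS (fun n => \sum_(X0 j <= l < n) (tau j l w)%:E)%E).
apply: is_cvg_nneseries => n Xn _.
by rewrite lee_fin ltW// tau_gt0.
Qed.

Lemma partial_time_lt_explosion j k : ((S j k w)%:E < T j w)%E.
Proof.
rewrite explosion_time_sup.
apply: (@lt_le_trans _ _ (S j (maxn k.+1 (X0 j)) w)%:E); last first.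
  by apply: ereal_sup_ubound; eexists.
by rewrite lte_fin partial_time_lt ?leq_maxr// leq_max ltnSn.
Qed.

Lemma lt_explosion_time j (t : \bar R) : (t < T j w)%E ->
  exists2 k, (X0 j <= k)%N & (t < (S j k w)%:E)%E.
Proof.
rewrite explosion_time_sup => /ereal_sup_gt[_ [k _ <-] tk].
exists (maxn k (X0 j)); first exact: leq_maxr.
by apply: (lt_le_trans tk); rewrite lee_fin partial_time_homo// leq_maxl.
Qed.

Lemma lt_urn j n (k : nat) : (X0 j <= k)%N ->
  (k%:R%:E < X j n w)%E <-> ((S j k w)%:E <= J n w)%E.
Proof.
move=> Xk; rewrite natbar_ltE; last exact: urn_natbar.
split=> [/le_urn|h]; first by apply; rewrite Xk ltnSn.
apply/le_urn => l /andP[_ lk]; apply: le_trans h.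
by rewrite lee_fin partial_time_homo.
Qed.

(** Induction on [n]: let [j0] explode first. Some partial sum [S j0 k] exceeds [J n], and at that
    time [j0] has left [k], so the next jump has occurred by then, strictly before [T j0]. *)
Lemma jump_time_lt n j : (J n w < T j w)%E.
Proof.
elim: n j => [|n IH] j /=.
  apply: lt_trans (partial_time_lt_explosion j (X0 j)).
  by rewrite lte_fin /partial_time big_nat1 tau_gt0.
have [j0 _ j0min] : exists2 j0, true & forall j, true -> (T j0 w <= T j w)%E.
  by case: (@arg_minP _ _ _ j predT (T ^~ w)) => // j0 _ h; exists j0.
have [k Xk Jk] := lt_explosion_time (IH j0).
apply: (@le_lt_trans _ _ (S j0 k w)%:E); last first.
  by apply: lt_le_trans (partial_time_lt_explosion j0 k) (j0min j isT).
apply: ereal_inf_lbound; exists (S j0 k w) => //; split=> // /(congr1 (@^~ j0)).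
move=> e; have := urn_le Xk Jk; rewrite /urn -e leNgt.
rewrite natbar_ltE; last exact: birth_proc_natbar.
move=> /negP; apply; apply/le_birth_proc => l /andP[_ lk].
exact: partial_time_homo.
Qed.

(** A jump time is an infimum, so a change must be shown to be visible at the infimum itself. This
    is right continuity of the paths, available because all coordinates are finite before [r]. *)
Lemma urn_step n (r : R) : (J n.+1 w < r%:E)%E -> (forall j, (r%:E < T j w)%E) ->
  exists j, (X j n w < X j n.+1 w)%E.
Proof.
move=> Jr rT; apply: contrapT => /forallNP noj.
have XE j : X j n.+1 w = X j n w.
  apply/eqP; rewrite eq_le [(_ <= X j n.+1 w)%E]urn_homo// andbT leNgt; exact/negP.
have /choice[k kE] j : exists k : nat, X j n.+1 w = k%:R%:E.
  have [k Xk rk] := lt_explosion_time (rT j).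
  apply: (natbar_lt (y := +oo%E)); first exact: urn_natbar.
  by rewrite (le_lt_trans (urn_le Xk (lt_trans Jr rk)))// ltry.
have := jump_time_ge0 n.+1 w; case EJ : (J n.+1 w) => [J'| |]//; last first.
  by move: Jr; rewrite EJ.
move=> _.
have XiE j : Xi j J' w = (k j)%:R%:E by rewrite -kE /urn EJ.
(* If nothing changed, all paths would be constant from [J'] until the first of the times
   [S j (k j)]; but an infimum below that minimum provides a time [t] of change before it. *)
have : (J n.+1 w < \big[Order.min/+oo]_j (S j (k j) w)%:E)%E.
  rewrite EJ; apply/bigmin_gtP; split; first by rewrite ltry.
  by move=> j _; rewrite lte_fin; exact: birth_proc_right.
move=> /ereal_inf_lt[_ [t Jtn <-]] /bigmin_gtP[_ tk].
have J't : (J n.+1 w <= t%:E)%E by apply: ereal_inf_lbound; exists t.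
case: Jtn => Jt tn.
apply: tn; apply/funext => j.
rewrite -[RHS]/(X j n w) -XE kE; apply/eqP; rewrite eq_le; apply/andP; split.
  rewrite leNgt natbar_ltE; last exact: birth_proc_natbar.
  apply/negP => /le_birth_proc h; have := tk j isT; rewrite lte_fin ltNge.
  move=> /negP; apply; apply: h; rewrite ltnSn andbT.
  have : ((X0 j)%:R%:E <= Xi j J' w)%E.
    apply/le_birth_proc => l /andP[h1 h2].
    by move: (leq_ltn_trans h1 h2); rewrite ltnn.
  by rewrite XiE lee_fin ler_nat.
rewrite -XiE; apply: birth_proc_homo.
by move: J't; rewrite EJ lee_fin.
Qed.

(** If all jump times stayed below [r], each coordinate would stay bounded, while every step raises
    the sum of the coordinates by at least one. *)
Lemma jump_time_exhaust (r : R) : (forall j, (r%:E < T j w)%E) ->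
  exists n, (r%:E <= J n w)%E.
Proof.
move=> rT; apply: contrapT => /forallNP Jr.
have {}Jr n : (J n w < r%:E)%E by rewrite ltNge; exact/negP.
have /choice[K XK] j : exists K : nat, forall n, (X j n w <= K%:R%:E)%E.
  have [k Xk rk] := lt_explosion_time (rT j).
  by exists k => n; apply: urn_le => //; exact: lt_trans (Jr n) rk.
have /choice[N' N'E] (nj : nat * 'I_A) :
    exists k : nat, X nj.2 nj.1 w = k%:R%:E.
  apply: (natbar_lt (y := +oo%E)); first exact: urn_natbar.
  by rewrite (le_lt_trans (XK nj.2 nj.1))// ltry.
pose N n j := N' (n, j); have NE n j : X j n w = (N n j)%:R%:E := N'E (n, j).
have Nn n : (n <= \sum_j N n j)%N.
  elim: n => // n IH.
  have [j0] := urn_step (Jr n.+1) rT.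
  rewrite !NE lte_fin ltr_nat => Nj0.
  apply: leq_ltn_trans IH _.
  rewrite (bigD1 j0)//= [ltnRHS](bigD1 j0)//= -addSn leq_add// leq_sum// => j _.
  by have := urn_homo j w (leqnSn n); rewrite !NE lee_fin ler_nat.
have := Nn (\sum_j K j).+1; rewrite ltnNge leq_sum// => j _.
by have := XK j (\sum_j K j).+1; rewrite NE lee_fin ler_nat.
Qed.

Variable i : 'I_A.
Local Notation M := (min_other_explosion X0 tau i).

(** The jump times stay below every explosion time and pass every real number below all of them. As
    [S i x w] is always less than [T i w], only the other agents matter. *)
Lemma urn_limit_gtE x : (X0 i <= x)%N ->
  (x%:R%:E < urn_limit X0 tau i w)%E <-> ((S i x w)%:E < M w)%E.
Proof.
move=> Xx; split.
  move=> /lt_urn_limit[n /(lt_urn _ Xx) SJ].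
  apply: (le_lt_trans SJ); apply/bigmin_gtP; split=> [|j _].
    exact: lt_le_trans (jump_time_lt n i) (leey _).
  exact: jump_time_lt.
move=> /bigmin_gtP[_ SM].
have [j|n Sn] := @jump_time_exhaust (S i x w).
  by have [->|/SM//] := eqVneq j i; exact: partial_time_lt_explosion.
by apply/lt_urn_limit; exists n; apply/lt_urn.
Qed.

(** Finiteness rules out the default value [+oo] of the minimum. *)
Lemma min_other_explosion_attained : (M w < +oo)%E ->
  exists2 j, j != i & T j w = M w.
Proof.
move=> Moo; have [j0 ji0 e] : exists2 j, j != i & (T j w <= M w)%E.
  apply: contrapT => nj; suff : (M w < M w)%E by rewrite ltxx.
  apply/bigmin_gtP; split=> // j ji; rewrite ltNge; apply/negP => jM.
  by apply: nj; exists j.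
by exists j0 => //; apply/eqP; rewrite eq_le e/=; exact: bigmin_le_cond.
Qed.

(** If [T i w < M w], all other coordinates are bounded along the jump times, hence stationary.
    Otherwise a minimizing [j0] explodes no later than [i], and its coordinate passes every
    level. *)
Lemma not_strong_monopolyE : (M w < +oo)%E ->
  (~` strong_monopoly X0 tau i) w <-> (M w <= T i w)%E.
Proof.
move=> Moo; split.
  apply: contra_notP => /negP; rewrite -ltNge => TM.
  have TMj j : j != i -> (T i w < T j w)%E.
    by move=> ji; move/bigmin_gtP : TM => [_]; apply.
  have /choice[N XN] j : exists N, j != i ->
      forall n, (N <= n)%N -> X j n w = X j N w.
    have [->|ji] := eqVneq j i; first by exists 0%N.
    have [k Xk Tk] := lt_explosion_time (TMj j ji).
    have [|N uN] := @natbar_stationary _ (X j ^~ w) k (fun n => urn_natbar j n w)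
      (urn_homo j w); last by exists N.
    by move=> n; apply: urn_le => //; exact: lt_trans (jump_time_lt n i) Tk.
  exists (\max_j N j)%N => n Nn j ji.
  by rewrite XN ?[RHS]XN// ?leq_bigmax// (leq_trans _ Nn)// leq_bigmax.
move=> MT [N XN].
have [j0 ji0 j0M] := min_other_explosion_attained Moo.
have j0T j : (T j0 w <= T j w)%E.
  rewrite j0M; have [->//|ji] := eqVneq j i; exact: bigmin_le_cond.
have [k Xk Jk] := lt_explosion_time (jump_time_lt N j0).
have [j|n Sn] := @jump_time_exhaust (S j0 k w).
  exact: lt_le_trans (partial_time_lt_explosion _ _) (j0T j).
have : (k%:R%:E < X j0 (maxn n N) w)%E.
  apply/lt_urn => //; apply: (le_trans Sn); apply: jump_time_homo.
  exact: leq_maxl.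
by rewrite XN ?leq_maxr// ltNge urn_le.
Qed.

End positive.
End paths.

(** * Measurability of jump times, urn limit and monopoly *)

Section measurability.
Context {d : measure_display} {Omega : measurableType d} {R : realType}.

Lemma cvgn_einf_esup (u : (\bar R)^nat) : limn_einf u = limn_esup u -> cvgn u.
Proof.
rewrite limn_einf_lim limn_esup_lim => e.
have h1 : einfs u @ \oo --> limn (esups u) by rewrite -e; exact: is_cvg_einfs.
apply: (cvgP (limn (esups u))).
apply: (squeeze_cvge _ h1); last exact: is_cvg_esups.
apply: nearW => n; rewrite ereal_inf_lbound ?ereal_sup_ubound//=; by exists n => /=.
Qed.

(* No convergence is assumed: [limn] takes a fixed default value on the measurable
   set of divergence. *)
Lemma measurable_limn (f : nat -> Omega -> \bar R) :
  (forall n, measurable_fun setT (f n)) ->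
  measurable_fun setT (fun x => limn (f ^~ x)).
Proof.
move=> mf; pose c x := `[< limn_einf (f ^~ x) = limn_esup (f ^~ x) >].
have msup := measurable_fun_limn_esup mf.
have minf : measurable_fun setT (fun x => limn_einf (f ^~ x)).
  rewrite (_ : (fun x => _) = (fun x => - limn_esup (fun n => - f n x))%E).
    apply: measurableT_comp => //; apply: measurable_fun_limn_esup => n.
    exact: measurableT_comp.
  apply/funext => x; rewrite -limn_einfN; congr limn_einf.
  by apply/funext => n /=; rewrite oppeK.
rewrite (_ : (fun x => _) = fun x => if c x then limn_esup (f ^~ x) else point).
  apply: measurable_fun_ifT => //; apply: (measurable_fun_bool true).
  rewrite (_ : _ @^-1` _ = setT `&` [set x | limn_einf (f ^~ x) = limn_esup (f ^~ x)]).
    by rewrite setTI; exact: measurable_eqe.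
  by rewrite setTI; apply/seteqP; split=> x /= /asboolP.
apply/funext => x; rewrite /c; case: asboolP => e.
  by have /cvg_limn_einf_sup[_ ->] := cvgn_einf_esup e.
apply: dvgP => /cvg_limn_einf_sup[? ?]; apply: e; congruence.
Qed.

Lemma measurable_natbar (f : Omega -> \bar R) : (forall x, natbar (f x)) ->
  (forall n : nat, measurable [set x | (n%:R%:E <= f x)%E]) ->
  measurable_fun setT f.
Proof.
move=> nf mf; apply: (measurability _ (ErealGenOInfty.measurableE R)) => _ [_ [r ->] <-].
rewrite setTI (_ : _ @^-1` _ =
    \bigcup_(n in [set n : nat | r < n%:R]) [set x | (n%:R%:E <= f x)%E]).
  exact: bigcup_measurable.
apply/seteqP; split=> x /=; rewrite in_itv/= andbT; last first.
  by move=> [n /= rn]; apply: lt_le_trans; rewrite lte_fin.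
have [e|[k e]] := nf x; rewrite ?e => rf; last by exists k; rewrite /= ?e// -lte_fin.
exists (Num.truncn r).+1; last by rewrite /= e leey.
exact: truncnS_gt.
Qed.

Variables (A : nat) (X0 : 'I_A -> nat) (tau : 'I_A -> nat -> Omega -> R).

(** The hypothesis covers only the indices summed, so that this lemma and the next two also apply
    when [Omega] carries the smaller sigma-algebra of a block of sojourn times. *)
Lemma measurable_partial_time j k :
  (forall l, (X0 j <= l <= k)%N -> measurable_fun setT (tau j l)) ->
  measurable_fun setT (partial_time X0 tau j k).
Proof.
move=> mtau; rewrite /partial_time.
under [X in measurable_fun _ X]eq_fun do rewrite big_nat_cond big_mkcond/=.
apply: measurable_sum => l; have [Xl|_] := boolP (X0 j <= l < k.+1)%N;
  [exact: mtau|exact: measurable_cst].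
Qed.

Lemma measurable_explosion_time j :
  (forall k, (X0 j <= k)%N -> measurable_fun setT (tau j k)) ->
  measurable_fun setT (explosion_time X0 tau j).
Proof.
move=> mtau; apply: measurable_limn => -[|k].
  by under [X in measurable_fun _ X]eq_fun do rewrite big_geq//; exact: measurable_cst.
under [X in measurable_fun _ X]eq_fun do rewrite sumEFin.
apply/measurable_EFinP/measurable_partial_time => l /andP[Xl _]; exact: mtau.
Qed.

Lemma measurable_min_other_explosion i :
  (forall j k, j != i -> (X0 j <= k)%N -> measurable_fun setT (tau j k)) ->
  measurable_fun setT (min_other_explosion X0 tau i).
Proof.
move=> mtau; rewrite /min_other_explosion; elim: (index_enum _) => [|j s IH].
  by under [X in measurable_fun _ X]eq_fun do rewrite big_nil; exact: measurable_cst.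
under [X in measurable_fun _ X]eq_fun do rewrite big_cons.
have [ji|//] := boolP (j != i); apply: measurable_mine => //.
by apply: measurable_explosion_time => k; exact: mtau.
Qed.

Hypothesis mtau : forall j k, (X0 j <= k)%N -> measurable_fun setT (tau j k).

Lemma measurable_birth_proc j t : measurable_fun setT (birth_proc X0 tau j t).
Proof.
apply: measurable_natbar => [w|n]; first exact: birth_proc_natbar.
rewrite (_ : [set w | _] = \bigcap_(l in [set l | (X0 j <= l < n)%N])
    [set w | partial_time X0 tau j l w <= t]).
  apply: bigcap_measurableType => // l _.
  rewrite -[X in measurable X]setTI -preimage_itvNyc.
  by apply: measurable_partial_time => // l0 /andP[Xl _]; exact: mtau.
by apply/seteqP; split=> w /= /le_birth_proc.
Qed.

(** A joint induction: the next jump time is defined through the current state, and the state at a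
    jump time is measurable through its thresholds. *)
Lemma measurable_jump_urn n : measurable_fun setT (jump_time X0 tau n) /\
  forall j, measurable_fun setT (urn X0 tau j n).
Proof.
have urn_of_jump m : measurable_fun setT (jump_time X0 tau m) ->
    forall j, measurable_fun setT (urn X0 tau j m).
  move=> mJ j; apply: measurable_natbar => [w|k]; first exact: urn_natbar.
  rewrite (_ : [set w | _] = \bigcap_(l in [set l | (X0 j <= l < k)%N])
      [set w | ((partial_time X0 tau j l w)%:E <= jump_time X0 tau m w)%E]).
    apply: bigcap_measurableType => // l _; rewrite -[X in measurable X]setTI.
    apply: measurable_lee => //; apply/measurable_EFinP.
    by apply: measurable_partial_time => // l0 /andP[Xl _]; exact: mtau.
  by apply/seteqP; split=> w /= /le_urn.
elim: n => [|n [mJ mX]].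
  have m0 : measurable_fun setT (jump_time X0 tau 0) by exact: measurable_cst.
  by split; [|exact: urn_of_jump].
suff mJS : measurable_fun setT (jump_time X0 tau n.+1).
  by split; [|exact: urn_of_jump].
apply: (measurability _ (ErealGenInftyO.measurableE R)) => _ [_ [r ->] <-].
(* Rational times suffice: paths are monotone, so a change seen at a time [t] is still seen at any
   rational between [t] and [r]. *)
rewrite setTI (_ : _ @^-1` _ = \bigcup_(q : rat) ([set w | ratr q < r] `&`
    ([set w | (jump_time X0 tau n w < (ratr q)%:E)%E] `&`
     \bigcup_j [set w | birth_proc X0 tau j (ratr q) w != urn X0 tau j n w]))).
  apply: bigcupT_measurable_rat => q; apply: measurableI.
    by have [|] := boolP (ratr q < r) => h;
      [rewrite (_ : [set _ | _] = setT)//|rewrite (_ : [set _ | _] = set0)//];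
      apply/seteqP; split=> // w /=; rewrite (negbTE h).
  apply: measurableI.
    by rewrite -[X in measurable X]setTI -preimage_itvNyo; exact/mJ/emeasurable_itv.
  apply: fin_bigcup_measurable => // j _.
  by rewrite -[X in measurable X]setTI; apply: measurable_neqe => //; exact: measurable_birth_proc.
apply/seteqP; split=> w /=; rewrite in_itv/=.
  move=> /ereal_inf_lt[_ [t [Jt tX] <-]]; rewrite lte_fin => tr.
  have [q] := rat_in_itvoo tr; rewrite in_itv/= => /andP[tq qr].
  exists q => //; split => //; split.
    by apply: (lt_trans Jt); rewrite lte_fin.
  apply: contrapT => nj; apply: tX; apply/funext => j.
  have XE : birth_proc X0 tau j (ratr q) w = urn X0 tau j n w.
    by apply/eqP/negPn/negP => h; apply: nj; exists j.
  apply/eqP; rewrite eq_le; apply/andP; split.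
    by rewrite -[leRHS]XE birth_proc_homo// ltW.
  apply: le_natbar; first exact: birth_proc_e_natbar.
  move=> k /le_urn h; apply/le_birth_proc => l /h /le_lt_trans/(_ Jt).
  by rewrite lte_fin => /ltW.
move=> [q _ [/= qr [Jq [j _ /= /eqP Xj]]]].
apply: (@le_lt_trans _ _ (ratr q)%:E); last by rewrite lte_fin.
apply: ereal_inf_lbound; exists (ratr q) => //; split=> // /(congr1 (@^~ j)).
exact: Xj.
Qed.

Lemma measurable_urn_limit j : measurable_fun setT (urn_limit X0 tau j).
Proof. by apply: measurable_limn => n; have [] := measurable_jump_urn n. Qed.

Lemma measurable_strong_monopoly i : measurable (strong_monopoly X0 tau i).
Proof.
rewrite (_ : strong_monopoly _ _ _ = \bigcup_N \bigcap_(n in [set n | (N <= n)%N])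
   \bigcap_(j in [set j | j != i])
     (setT `&` [set w | urn X0 tau j n w = urn X0 tau j N w])).
  apply: bigcupT_measurable => N; apply: bigcap_measurableType => // n _.
  apply: fin_bigcap_measurable; first exact: finite_finset.
  move=> j _; apply: measurable_eqe => //.
    by have [] := measurable_jump_urn n.
  by have [] := measurable_jump_urn N.
apply/seteqP; split=> w /= [N]; first by move=> h; exists N => // n Nn j ji; split => //; exact: h.
by move=> _ h; exists N => n Nn j ji; have [] := h n Nn j ji.
Qed.

End measurability.

(** * Image measures and independence *)

Section density.
Context {d : measure_display} {T : measurableType d} {R : realType}.
Variables (mu nu : {measure set T -> \bar R}) (f : T -> R).
Hypotheses (mf : measurable_fun setT f) (f0 : forall x, 0 <= f x).
Hypothesis nuE : forall B, measurable B -> nu B = (\int[mu]_(x in B) (f x)%:E)%E.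

Import HBNNSimple.

Lemma ge0_integral_density (h : T -> \bar R) :
  measurable_fun setT h -> (forall x, 0 <= h x)%E ->
  (\int[nu]_x h x = \int[mu]_x (h x * (f x)%:E))%E.
Proof.
move=> mh h0; pose s := nnsfun_approx measurableT mh.
have mef : measurable_fun setT (EFin \o f) by exact/measurable_EFinP.
have snd x : {homo (s ^~ x) : a b / (a <= b)%N >-> (a <= b)%R}.
  by move=> a b ab; exact/lefP/nd_nnsfun_approx.
transitivity (lim ((\int[nu]_x (EFin \o s n) x) @[n --> \oo]))%E.
  rewrite -monotone_convergence//.
  - apply: eq_integral => x _; apply/esym/cvg_lim => //.
    by apply: (cvg_nnsfun_approx measurableT mh) => // *; exact: h0.
  - by move=> n; exact/measurable_EFinP.
  - by move=> n x _; rewrite lee_fin.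
  - by move=> x _ a b ab; rewrite lee_fin; exact: snd.
transitivity (lim ((\int[mu]_x ((EFin \o s n) x * (f x)%:E)) @[n --> \oo]))%E; last first.
  rewrite -monotone_convergence//.
  - apply: eq_integral => x _; apply/cvg_lim => //.
    apply: cvgeZr => //; apply: (cvg_nnsfun_approx measurableT mh) => // *.
  - by move=> n; apply: emeasurable_funM => //; exact/measurable_EFinP.
  - by move=> n x _; rewrite mule_ge0// lee_fin.
  - by move=> x _ a b ab /=; rewrite -!EFinM lee_fin ler_wpM2r//; exact: snd.
apply: (congr1 (fun u : (\bar R)^nat => limn u)); apply/funext => n.
have indich m r : measurable_fun setT (fun x : T => (r * \1_(s m @^-1` [set r]) x)%:E).
  by apply/measurable_EFinP; exact: measurable_funM.
transitivity (\int[nu]_x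
   (\sum_(y \in range (s n)) (y * \1_(s n @^-1` [set y]) x)%:E))%E.
  by apply: eq_integral => t _; rewrite /= fimfunE -fsumEFin.
rewrite ge0_integral_fsum//; last by move=> m y Ey; exact: nnfun_muleindic_ge0.
transitivity (\int[mu]_x (\sum_(y \in range (s n))
    (y * \1_(s n @^-1` [set y]) x)%:E * (f x)%:E))%E; last first.
  apply: eq_integral => x _.
  rewrite -ge0_mule_fsuml => [|y]; last exact: nnfun_muleindic_ge0.
  by rewrite fsumEFin // -(fimfunE _ x).
rewrite ge0_integral_fsum//; last 2 first.
  - by move=> y; exact: emeasurable_funM.
  - by move=> m y Ey; rewrite mule_ge0 ?lee_fin// -lee_fin nnfun_muleindic_ge0.
apply: eq_fsbigr => r rsn.
under eq_integral do rewrite EFinM.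
rewrite integralZl_indic_nnsfun//.
under [RHS]eq_integral do rewrite EFinM -muleA.
rewrite ge0_integralZl//; last 3 first.
- by apply: emeasurable_funM => //; exact/measurable_EFinP.
- by move=> t _; rewrite mule_ge0// lee_fin.
- by move: rsn; rewrite inE => -[t _ <-]; rewrite lee_fin.
congr (_ * _)%E; rewrite integral_indic// setIT nuE//.
rewrite integral_mkcond; apply: eq_integral => x _.
by rewrite epatch_indic muleC.
Qed.

End density.

(** * Independence of disjoint blocks of variables *)

Section sub_sigma.
Context {d : measure_display} {Omega : measurableType d} {R : realType}.
Variable P : probability Omega R.

Definition indep_sets (G H : set_system Omega) :=
  forall E F, G E -> H F -> P (E `&` F) = (P E * P F)%E.

(** For fixed [F], the finite measures [E |-> P (E & F)] and [E |-> P E * P F] agree on a pi-system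
    containing the whole space, hence on the sigma-algebra it generates. *)
Lemma indep_sets_gen1 G F : setI_closed G -> G setT -> G `<=` measurable ->
  measurable F -> (forall E, G E -> P (E `&` F) = (P E * P F)%E) ->
  forall E, <<s G >> E -> P (E `&` F) = (P E * P F)%E.
Proof.
move=> GI GT mG mF GF E sGE.
have PF0 : 0 <= fine (P F) by rewrite fine_ge0.
pose m2 : {measure set Omega -> \bar R} := mscale (NngNum PF0) P.
have m2E B : m2 B = (P B * P F)%E.
  by rewrite /m2/= /mscale/= fineK ?fin_num_measure// muleC.
rewrite -m2E -[LHS]/(mrestr P mF E).
apply: (g_sigma_algebra_measure_unique G mG (fun=> setT) _ _ (mrestr P mF)) => //.
- by rewrite bigcup_const.
- by move=> B GB /=; rewrite /mrestr GF//; exact/esym/m2E.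
- by move=> _; rewrite /= /mrestr setTI (le_lt_trans (probability_le1 _ _))// ltry.
Qed.

Lemma indep_sets_gen G H :
  setI_closed G -> G setT -> G `<=` measurable ->
  setI_closed H -> H setT -> H `<=` measurable ->
  indep_sets G H -> indep_sets <<s G >> <<s H >>.
Proof.
move=> GI GT mG HI HT mH GH E F sGE sHF.
have mF : measurable F.
  by apply: sHF; split => //; exact: sigma_algebra_measurable.
apply: (indep_sets_gen1 GI GT mG mF _ sGE) => E' GE'.
rewrite setIC muleC; apply: (indep_sets_gen1 HI HT mH (mG _ GE') _ sHF).
by move=> F' HF'; rewrite setIC muleC; exact: GH.
Qed.

Context {I : choiceType} (Idx : I -> Prop) (X : I -> Omega -> R).
Hypothesis mX : forall j, Idx j -> measurable_fun setT (X j).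
Hypothesis indX : mutually_independent P Idx X.

Definition cylinders (K : set I) : set_system Omega :=
  [set E | exists (J : seq I) (B : I -> set R),
     [/\ uniq J, forall j, j \in J -> K j, forall j, measurable (B j) &
         E = \big[setI/setT]_(j <- J) (X j @^-1` B j)]].

Lemma cylindersT K : cylinders K setT.
Proof. by exists [::], (fun=> setT); split=> //; rewrite big_nil. Qed.

Lemma cylinders_measurable K : K `<=` Idx -> cylinders K `<=` measurable.
Proof.
move=> KI _ [J [B [uJ JK mB ->]]]; rewrite big_seq.
apply: bigsetI_measurable => j jJ; rewrite -[_ @^-1` _]setTI.
by apply: mX => //; exact/KI/JK.
Qed.

Lemma cylinders_setI K : setI_closed (cylinders K).
Proof.
move=> _ _ [J [B [uJ JK mB ->]]] [J' [B' [uJ' JK' mB' ->]]].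
(* The two index lists may overlap; an index absent from one of them contributes [setT] on that
   side. *)
exists (undup (J ++ J')), (fun j => (if j \in J then B j else setT) `&`
  (if j \in J' then B' j else setT)); split.
- exact: undup_uniq.
- by move=> j; rewrite mem_undup mem_cat => /orP[/JK|/JK'].
- by move=> j; apply: measurableI; case: ifP.
- rewrite -!bigcap_seq. apply/seteqP; split=> w.
    by move=> [JB JB'] j _; split; case: ifPn => // jJ; [exact: JB|exact: JB'].
  move=> h; split=> j /= jJ.
    have /h[/=] : j \in undup (J ++ J') by rewrite mem_undup mem_cat jJ.
    by rewrite jJ.
  have /h[/= _] : j \in undup (J ++ J') by rewrite mem_undup mem_cat jJ orbT.
  by rewrite jJ.
Qed.

(** Disjointness of the index sets allows both families of Borel sets to be merged into a single
    [C], to which mutual independence applies three times: on [J], on [J'] and on their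
    concatenation. *)
Lemma cylinders_indep K L : K `<=` Idx -> L `<=` Idx -> K `&` L = set0 ->
  indep_sets (cylinders K) (cylinders L).
Proof.
move=> KI LI KL _ _ [J [B [uJ JK mB ->]]] [J' [B' [uJ' JK' mB' ->]]].
have JJ' j : j \in J' -> j \notin J.
  by move=> /JK' Lj; apply/negP => /JK Kj; have : (K `&` L) j by []; rewrite KL.
pose C j := if j \in J then B j else B' j.
have CJ : \big[setI/setT]_(j <- J) (X j @^-1` B j) =
    \big[setI/setT]_(j <- J) (X j @^-1` C j).
  by apply: eq_big_seq => j jJ; rewrite /C jJ.
have CJ' : \big[setI/setT]_(j <- J') (X j @^-1` B' j) =
    \big[setI/setT]_(j <- J') (X j @^-1` C j).
  by apply: eq_big_seq => j /JJ'/negbTE jJ; rewrite /C jJ.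
have mC j : measurable (C j) by rewrite /C; case: ifP.
have JI j : j \in J -> Idx j by move=> /JK /KI.
have JI' j : j \in J' -> Idx j by move=> /JK' /LI.
rewrite CJ CJ' -big_cat !indX ?big_cat//.
  by rewrite cat_uniq uJ uJ' andbT /=; apply/hasPn => j /JJ'.
by move=> j; rewrite mem_cat => /orP[/JI|/JI'].
Qed.

(** [Omega] with the sigma-algebra generated by the [X j], [j] in [K]. Measurability from this type
    says that a variable depends only on that block, and the general measurability lemmas prove
    it. *)
Definition blockType (K : set I) := g_sigma_algebraType (cylinders K).

Lemma block_measurable K j : K j ->
  measurable_fun (setT : set (blockType K)) (X j).
Proof.
move=> Kj _ B mB; rewrite setTI; apply: sub_sigma_algebra.
exists [:: j], (fun=> B); split => //; last by rewrite big_seq1.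
by move=> k; rewrite inE => /eqP ->.
Qed.

Definition indep_vars d1 d2 (T1 : measurableType d1) (T2 : measurableType d2)
    (Y : Omega -> T1) (Z : Omega -> T2) :=
  forall B C, measurable B -> measurable C ->
    P (Y @^-1` B `&` Z @^-1` C) = (P (Y @^-1` B) * P (Z @^-1` C))%E.

Lemma block_indep d1 d2 (T1 : measurableType d1) (T2 : measurableType d2)
    K L (Y : Omega -> T1) (Z : Omega -> T2) :
  K `<=` Idx -> L `<=` Idx -> K `&` L = set0 ->
  measurable_fun (setT : set (blockType K)) Y ->
  measurable_fun (setT : set (blockType L)) Z ->
  indep_vars Y Z.
Proof.
move=> KI LI KL mY mZ B C mB mC.
have := indep_sets_gen (@cylinders_setI K) (cylindersT K)
  (cylinders_measurable KI) (@cylinders_setI L) (cylindersT L)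
  (cylinders_measurable LI) (cylinders_indep KI LI KL).
apply.
  by have := mY measurableT _ mB; rewrite setTI.
by have := mZ measurableT _ mC; rewrite setTI.
Qed.

(** The joint law is the product of the marginal laws by uniqueness on rectangles; Tonelli then
    allows [Z] to be frozen while [Y] is integrated out. *)
Lemma indep_integral d1 d2 (T1 : measurableType d1) (T2 : measurableType d2)
    (Y : Omega -> T1) (Z : Omega -> T2) (phi : T1 * T2 -> \bar R) :
  measurable_fun setT Y -> measurable_fun setT Z -> indep_vars Y Z ->
  measurable_fun setT phi -> (forall x, 0 <= phi x)%E ->
  (\int[P]_w phi (Y w, Z w) = \int[P]_w \int[P]_w' phi (Y w', Z w))%E.
Proof.
move=> mY mZ YZ mphi phi0.
pose Y' : {mfun Omega >-> T1} := HB.pack Y (isMeasurableFun.Build _ _ _ _ _ mY).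
pose Z' : {mfun Omega >-> T2} := HB.pack Z (isMeasurableFun.Build _ _ _ _ _ mZ).
have mYZ : measurable_fun setT (fun w => (Y w, Z w)) by exact: measurable_fun_pair.
pose W : {mfun Omega >-> (T1 * T2)%type} :=
  HB.pack (fun w => (Y w, Z w)) (isMeasurableFun.Build _ _ _ _ _ mYZ).
transitivity (\int[distribution P W]_x phi x)%E.
  by rewrite ge0_integral_distribution.
transitivity (\int[distribution P Y' \x distribution P Z']_x phi x)%E.
  apply: eq_measure_integral => B mB _; apply/esym.
  by apply: product_measure_unique => // B1 B2 mB1 mB2; exact: YZ.
rewrite fubini_tonelli1// fubini_tonelli// ge0_integral_distribution.
- apply: eq_integral => w _ /=; rewrite /fubini_G ge0_integral_distribution//.
  by apply: measurableT_comp => //; exact: pair2_measurable.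
- exact: measurable_fun_fubini_tonelli_G.
- by move=> z; apply: integral_ge0.
Qed.

End sub_sigma.

(** * Exponential laws *)

Section exponential_law.
Context {R : realType}.
Local Notation mu := lebesgue_measure.

Lemma lebesgue_measure_shift (z : R) (A : set R) : measurable A ->
  pushforward mu ((fun x => z + x) : _ -> measurableTypeR R) A = mu A.
Proof.
have mz : measurable_fun setT (fun x : R => z + x) by exact: measurable_funD.
move=> mA; apply/esym/lebesgue_measure_unique => //= _ [[a b]] _ <-.
rewrite /pushforward (_ : _ @^-1` _ = `]a - z, b - z]%classic); last first.
  by apply/seteqP; split=> x /=; rewrite !in_itv/= ltrBlDl lerBrDl.
rewrite !lebesgue_measure_itv/= !lte_fin ltrD2r -!EFinB.
by congr (if _ then _%:E else _); ring.
Qed.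

Lemma ge0_integral_shift (h : R -> \bar R) (z : R) :
  measurable_fun setT h -> (forall x, 0 <= h x)%E ->
  (\int[mu]_x h (z + x)%R = \int[mu]_x h x)%E.
Proof.
move=> mh h0.
have mz : measurable_fun setT (fun x : R => z + x) by exact: measurable_funD.
rewrite -[LHS](@ge0_integral_pushforward _ _ (measurableTypeR R) (measurableTypeR R) R
  (fun x => z + x) mz mu setT h)//.
by apply: eq_measure_integral => //= A mA _; exact: lebesgue_measure_shift.
Qed.

Lemma is_derive_cexpR (c k x : R) :
  is_derive x 1 (fun s => c * expR (k * s)) (c * k * expR (k * x)).
Proof.
apply: is_derive_eq.
by rewrite /= !scaler1 /GRing.scale/=; ring.
Qed.

Lemma continuous_cexpR (c k : R) : continuous (fun s : R => c * expR (k * s)).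
Proof.
move=> x; apply: differentiable_continuous; apply/derivable1_diffP.
by have [] := is_derive_cexpR c k x.
Qed.

Lemma exponential_prob_tail (a t : R) : 0 < a -> 0 <= t ->
  exponential_prob a `[t, +oo[ = (expR (- a * t))%:E.
Proof.
move=> a0 t0; rewrite /exponential_prob.
rewrite (_ : (expR _)%:E = 0%:E - ((-1) * expR (- a * t))%:E)%E; last first.
  by rewrite sub0e -EFinN mulN1r opprK.
rewrite -(@ge0_continuous_FTC2y _ (fun x => a * expR (- a * x))
    (fun x => (-1) * expR (- a * x)) t 0).
- apply: eq_integral => x; rewrite inE/= in_itv/= andbT => tx.
  by rewrite exponential_pdfE// (le_trans t0).
- by move=> x _; rewrite mulr_ge0 ?expR_ge0// ltW.
- exact/continuous_subspaceT/continuous_cexpR.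
- rewrite -[0](mulr0 (-1)); apply: cvgMl_tmp.
  rewrite (_ : (fun x => _) = (fun z => expR (- z)) \o (fun z => a * z)); last first.
    by apply: eq_fun => x; rewrite mulNr.
  apply: (@cvg_comp _ _ _ _ _ _ (pinfty_nbhs R)); last exact: cvgr_expR.
  exact: gt0_cvgMry.
- by move=> x _; have [] := is_derive_cexpR (-1) (- a) x.
- by apply: cvg_at_right_filter; exact: continuous_cexpR.
- move=> x _; rewrite derive1E; have [_ ->] := is_derive_cexpR (-1) (- a) x.
  by rewrite mulN1r opprK.
Qed.

Lemma exponential_prob_le0 (a : R) : exponential_prob a `]-oo, 0] = 0%E.
Proof.
rewrite /exponential_prob -integral_itv_bndo_bndc//.
  rewrite integral0_eq// => x; rewrite /= in_itv/= => x0.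
  by rewrite lt0_exponential_pdf.
apply/measurable_funTS/measurable_EFinP; exact: measurable_exponential_pdf.
Qed.

Lemma exponential_pdf_le (a x : R) : 0 < a -> exponential_pdf a x <= a.
Proof.
move=> a0; have [x0|x0] := ltP x 0; first by rewrite lt0_exponential_pdf ?ltW.
rewrite exponential_pdfE//; apply: ler_piMr; first exact: ltW.
rewrite -expR0 ler_expR.
by rewrite mulNr oppr_le0 mulr_ge0// ltW.
Qed.

Lemma measurable_max0 : measurable_fun setT (fun x : R => Num.max x 0).
Proof. by have := measurable_maxr (@measurable_id _ R setT) (measurable_cst (0:R)). Qed.

(* With [s <= (2 / a) e^(a s / 2)], the mean is dominated by the total mass of
   the exponential law of rate [a / 2]. *)
Lemma exponential_mean_le (a : R) : 0 < a ->
  (\int[mu]_s ((Num.max s 0)%:E * (exponential_pdf a s)%:E) <= (4 / a)%:E)%E.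
Proof.
move=> a0.
have a20 : 0 < a / 2 by rewrite divr_gt0.
have mpdf c : measurable_fun setT (EFin \o @exponential_pdf R c).
  by apply/measurable_EFinP; exact: measurable_exponential_pdf.
have pdf0 c s : 0 < c -> (0 <= (@exponential_pdf R c s)%:E)%E.
  by move=> c0; rewrite lee_fin exponential_pdf_ge0// ltW.
have mmax : measurable_fun setT (fun s : R => (Num.max s 0)%:E).
  by apply/measurable_EFinP; exact: measurable_max0.
apply: (@le_trans _ _ (\int[mu]_s ((4 / a)%:E * (exponential_pdf (a / 2) s)%:E))%E).
  apply: ge0_le_integral => //=.
  - by move=> s _; rewrite mule_ge0 ?pdf0// lee_fin le_max lexx orbT.
  - exact: (emeasurable_funM mmax (mpdf a)).
  - exact: (emeasurable_funM (measurable_cst (4 / a)%:E) (mpdf (a / 2))).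
  - move=> s _; rewrite -!EFinM lee_fin.
    have [s0|s0] := ltP s 0.
      by rewrite !lt0_exponential_pdf// !mulr0.
    rewrite !exponential_pdfE//.
    have -> : 4 / a * (a / 2 * expR (- (a / 2) * s)) = 2 * expR (- (a / 2) * s).
      by field; rewrite gt_eqF.
    have -> : - a * s = - (a / 2) * s + - (a / 2) * s by field.
    rewrite expRD; set e := expR _.
    have e0 : 0 < e by exact: expR_gt0.
    have ee : expR (a / 2 * s) * e = 1 by rewrite -expRD mulNr subrr expR0.
    apply: (@le_trans _ _ (2 * (expR (a / 2 * s) * e) * e)); last by rewrite ee mulr1.
    rewrite (_ : s * _ = 2 * (a / 2 * s * e) * e); last by field.
    rewrite ler_pM2r// ler_pM2l// ler_pM2r//.
    by apply: le_trans (expR_ge1Dx _); rewrite lerDr.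
rewrite ge0_integralZl//.
- by rewrite integral_exponential_pdf// mule1.
- exact: (mpdf (a / 2)).
- by move=> s _; exact: pdf0.
- by rewrite lee_fin divr_ge0// ltW.
Qed.

(** The factor [expR (- b * (y - s))] is the probability that a sojourn of rate [b] lasts at least
    [y - s]. The denominator [b - a] comes from the primitive of [expR ((b - a) * s)]. *)
Lemma exponential_convolution (a b y : R) : 0 < a -> a != b ->
  (\int[mu]_s ((if (s < y)%R then expR (- b * (y - s)) else 0)%:E *
     (exponential_pdf a s)%:E))%E =
  (if 0 < y then a * (expR (- a * y) - expR (- b * y)) / (b - a) else 0)%:E.
Proof.
move=> a0 ab; have ba0 : b - a != 0 by rewrite subr_eq0 eq_sym.
case: ifPn => [y0|]; last first.
  rewrite -leNgt => y0; apply: integral0_eq => s _.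
  case: ifPn => sy; last by rewrite mul0e.
  by rewrite lt0_exponential_pdf ?mule0// (lt_le_trans sy).
pose F s := (a * expR (- b * y) / (b - a)) * expR ((b - a) * s).
pose f s := (a * expR (- b * y)) * expR ((b - a) * s).
transitivity (\int[mu]_(s in `[0%R, y]) (f s)%:E)%E.
  rewrite -integral_itv_bndo_bndc//; last first.
    apply/measurable_EFinP; apply: measurable_funM => //.
    apply: measurableT_comp => //; exact: measurable_funM.
  rewrite [RHS]integral_mkcond; apply: eq_integral => s _.
  rewrite patchE mem_setE in_itv/=; case: ifPn => sy; rewrite ?andbT ?andbF ?mul0e//.
  case: ifPn => s0; last by rewrite lt0_exponential_pdf ?mule0// ltNge.
  rewrite exponential_pdfE// -EFinM /f; congr EFin.
  rewrite mulrCA -expRD -mulrA -expRD; congr (_ * expR _); ring.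
rewrite (continuous_FTC2 (F := F))//.
- rewrite -EFinB /F mulr0 expR0 mulr1; congr EFin.
  rewrite (_ : - a * y = - b * y + (b - a) * y); last by ring.
  by rewrite expRD; field.
- exact/continuous_subspaceT/continuous_cexpR.
- have dF x : derivable F x 1.
    by have [] := is_derive_cexpR (a * expR (- b * y) / (b - a)) (b - a) x.
  have cF : continuous F by exact: continuous_cexpR.
  split => //; first exact/cvg_at_right_filter/cF.
  exact/cvg_at_left_filter/cF.
- move=> x _; rewrite derive1E.
  have [_ ->] := is_derive_cexpR (a * expR (- b * y) / (b - a)) (b - a) x.
  by rewrite /f; field.
Qed.

Context {d : measure_display} {Omega : measurableType d}.
Variable P : probability Omega R.

Section law.
Variables (a : R) (t : Omega -> R).
Hypotheses (a0 : 0 < a) (mt : measurable_fun setT t).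
Hypothesis tE : forall B, measurable B -> P (t @^-1` B) = exponential_prob a B.

Lemma exponential_expectation (h : R -> \bar R) :
  measurable_fun setT h -> (forall x, 0 <= h x)%E ->
  (\int[P]_w h (t w) = \int[mu]_s (h s * (exponential_pdf a s)%:E))%E.
Proof.
move=> mh h0.
have mt' : measurable_fun setT (t : Omega -> measurableTypeR R) by [].
pose t' : {mfun Omega >-> measurableTypeR R} :=
  HB.pack (t : Omega -> measurableTypeR R) (isMeasurableFun.Build _ _ _ _ _ mt').
rewrite -(@ge0_integral_density _ (measurableTypeR R) R mu (distribution P t') (exponential_pdf a))//.
- by rewrite ge0_integral_distribution.
- exact: measurable_exponential_pdf.
- by move=> x; rewrite exponential_pdf_ge0// ltW.
Qed.

Lemma exponential_gt0 : P [set w | t w <= 0] = 0%E.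
Proof. by rewrite -(exponential_prob_le0 a) -tE// set_itvE. Qed.

Lemma exponential_ge (s : R) : 0 <= s -> P [set w | s <= t w] = (expR (- a * s))%:E.
Proof. by move=> s0; rewrite -exponential_prob_tail// -tE// set_itvE. Qed.

Lemma exponential_mean : (\int[P]_w (Num.max (t w) 0)%:E <= (4 / a)%:E)%E.
Proof.
rewrite (exponential_expectation (h := fun s => (Num.max s 0)%:E)).
- exact: exponential_mean_le.
- by apply/measurable_EFinP; exact: measurable_max0.
- by move=> s; rewrite lee_fin le_max lexx orbT.
Qed.

Lemma exponential_indep_integral (Z : Omega -> R) (phi : R -> R -> \bar R) :
  measurable_fun setT Z -> indep_vars P t Z ->
  measurable_fun setT (fun x => phi x.1 x.2) -> (forall x z, 0 <= phi x z)%E ->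
  (\int[P]_w phi (t w) (Z w) =
   \int[P]_w \int[mu]_s (phi s (Z w) * (exponential_pdf a s)%:E))%E.
Proof.
move=> mZ tZ mphi phi0.
rewrite (indep_integral (phi := fun x => phi x.1 x.2) mt mZ tZ)//.
apply: eq_integral => w _.
rewrite (exponential_expectation (h := phi ^~ (Z w)))//.
exact: (measurableT_comp mphi (pair2_measurable _)).
Qed.

(** With [Z] frozen, the density is at most [a] and Lebesgue measure is translation invariant, so
    the probability is at most [a] times the measure of [N]. *)
Lemma exponential_indep_ac (Z : Omega -> R) (N : set R) :
  measurable_fun setT Z -> indep_vars P t Z -> measurable N -> mu N = 0%E ->
  P [set w | N (Z w + t w)] = 0%E.
Proof.
move=> mZ tZ mN N0.
have mD : measurable_fun setT (fun x : R * R => x.2 + x.1).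
  exact: measurable_funD.
have mE : measurable [set w | N (Z w + t w)].
  rewrite -[X in measurable X]setTI.
  by apply: (measurable_funD mZ mt) => //.
have mI : measurable_fun setT (fun x : R => (\1_N x : R)%:E).
  by apply/measurable_EFinP; exact: measurable_indic.
rewrite -[X in P X]setIT -integral_indic//.
rewrite [LHS](exponential_indep_integral (phi := fun s z => (\1_N (z + s))%:E) mZ tZ)//.
- apply: integral0_eq => w _; apply/eqP; rewrite eq_le; apply/andP; split; last first.
    by apply: integral_ge0 => s _; rewrite mule_ge0// lee_fin// exponential_pdf_ge0// ltW.
  have mIZ : measurable_fun setT (fun s : R => (\1_N (Z w + s) : R)%:E).
    by apply: (measurableT_comp mI); exact: measurable_funD.
  apply: (@le_trans _ _ (\int[mu]_s (a%:E * (\1_N (Z w + s)%R)%:E))%E).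
    apply: ge0_le_integral => //=.
    - by move=> s _; rewrite mule_ge0// lee_fin// exponential_pdf_ge0// ltW.
    - apply: (emeasurable_funM mIZ); apply/measurable_EFinP.
      exact: measurable_exponential_pdf.
    - exact: (emeasurable_funM (measurable_cst a%:E) mIZ).
    - by move=> s _; rewrite muleC lee_wpmul2r// lee_fin exponential_pdf_le.
  rewrite ge0_integralZl//; last by rewrite lee_fin ltW.
  rewrite (ge0_integral_shift (h := fun s => (\1_N s)%:E))//.
  suff -> : (\int[mu]_x (\1_N x : R)%:E = 0)%E by rewrite mule0.
  by rewrite integral_indic// setIT; exact: N0.
- exact: (measurableT_comp mI mD).
Qed.

(** The previous lemma for [- Z] and the null set [{0}]. *)
Lemma exponential_indep_neq (Z : Omega -> R) :
  measurable_fun setT Z -> indep_vars P t Z -> P [set w | t w = Z w] = 0%E.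
Proof.
move=> mZ tZ.
have mE : measurable [set w | t w = Z w].
  rewrite (_ : [set w | _] = (fun w => t w - Z w) @^-1` [set 0]); last first.
    apply/seteqP; split=> w /=; first by move=> ->; rewrite subrr.
    by move=> /eqP; rewrite subr_eq0 => /eqP.
  by rewrite -[X in measurable X]setTI; apply: (measurable_funB mt mZ).
have tNZ : indep_vars P t (fun w => - Z w).
  move=> B C mB mC.
  have := tZ B (-%R @^-1` C) mB; apply.
  by rewrite -[X in measurable X]setTI; apply: (oppr_measurable measurableT).
have := exponential_indep_ac (measurable_funN mZ) tNZ
  (measurable_set1 0) (lebesgue_measure_set1 0).
move=> <-; congr (P _); apply/seteqP; split=> w /=.
  by move=> ->; rewrite addNr.
by move=> /eqP; rewrite addrC subr_eq0 => /eqP.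
Qed.

End law.
End exponential_law.

(** * Two exponential times around a threshold, and the limit of large rate *)

Section hypoexponential.
Context {R : realType} {d : measure_display} {Omega : measurableType d}.
Variable P : probability Omega R.

Lemma measurable_set_ltr (f h : Omega -> R) :
  measurable_fun setT f -> measurable_fun setT h -> measurable [set w | f w < h w].
Proof.
move=> /measurable_EFinP mf /measurable_EFinP mh.
by have := measurable_lte measurableT mf mh; rewrite setTI.
Qed.

Lemma measurable_set_ler (f h : Omega -> R) :
  measurable_fun setT f -> measurable_fun setT h -> measurable [set w | f w <= h w].
Proof.
move=> /measurable_EFinP mf /measurable_EFinP mh.
by have := measurable_lee measurableT mf mh; rewrite setTI.
Qed.

(* P(t0 < y <= t0 + t) for independent exponential t0 and t of rates a and b;
   meaningless when a = b. *)
Definition hypo_kernel (a b y : R) : R :=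
  if 0 < y then a * (expR (- a * y) - expR (- b * y)) / (b - a) else 0.

(** First [t] is integrated out with [Y - t0] frozen, leaving its exponential tail [psi]; then [t0]
    is integrated out with [Y] frozen, which is [exponential_convolution]. *)
Lemma hypoexponential_between (a b : R) (t0 t Y : Omega -> R) :
  0 < a -> 0 < b -> a != b ->
  measurable_fun setT t0 -> measurable_fun setT t -> measurable_fun setT Y ->
  (forall B, measurable B -> P (t0 @^-1` B) = exponential_prob a B) ->
  (forall B, measurable B -> P (t @^-1` B) = exponential_prob b B) ->
  indep_vars P t0 Y -> indep_vars P t (fun w => Y w - t0 w) ->
  P [set w | t0 w < Y w <= t0 w + t w] =
  (\int[P]_w (hypo_kernel a b (Y w))%:E)%E.
Proof.
move=> a0 b0 ab mt0 mt mY t0E tE t0Y tY.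
have mZ : measurable_fun setT (fun w => Y w - t0 w) by exact: measurable_funB.
pose phi (s z : R) : R := if (0 < z) && (z <= s) then 1 else 0.
have mphi : measurable_fun setT (fun x : R * R => (phi x.1 x.2)%:E).
  apply/measurable_EFinP; apply: measurable_fun_ifT => //.
  apply: measurable_and; first exact: measurable_fun_ltr.
  exact: measurable_fun_ler.
pose psi (s y : R) : R := if s < y then expR (- b * (y - s)) else 0.
have mpsi : measurable_fun setT (fun x : R * R => (psi x.1 x.2)%:E).
  apply/measurable_EFinP; apply: measurable_fun_ifT => //.
    exact: measurable_fun_ltr.
  apply: measurableT_comp => //; apply: measurable_funM => //.
  exact: measurable_funB.
have phi0 s z : (0 <= (phi s z)%:E)%E by rewrite lee_fin /phi; case: ifP.
have psi0 s z : (0 <= (psi s z)%:E)%E.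
  by rewrite lee_fin /psi; case: ifP => // _; exact: expR_ge0.
have mE : measurable [set w | t0 w < Y w <= t0 w + t w].
  rewrite (_ : [set w | _] = [set w | t0 w < Y w] `&` [set w | Y w <= t0 w + t w]).
    apply: measurableI; first exact: measurable_set_ltr.
    exact: (measurable_set_ler mY (measurable_funD mt0 mt)).
  by apply/seteqP; split=> w /= => [/andP[]|[-> ->]].
rewrite -[X in P X]setIT -integral_indic//.
transitivity (\int[P]_w (phi (t w) (Y w - t0 w))%:E)%E.
  apply: eq_integral => w _; rewrite indicE /phi subr_gt0 lerBlDl; congr EFin.
  by case: ifPn => h; [rewrite mem_set|rewrite memNset//; exact/negP].
rewrite (indep_integral (phi := fun x => (phi x.1 x.2)%:E) mt mZ tY)//=.
transitivity (\int[P]_w (psi (t0 w) (Y w))%:E)%E.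
  apply: eq_integral => w _; rewrite /phi /psi subr_gt0.
  case: ifPn => [tYw|_]; last exact: integral0_eq.
  rewrite -(exponential_ge b0 tE); last by rewrite subr_ge0 ltW.
  rewrite -[X in P X]setIT -integral_indic//; last first.
    rewrite -[X in measurable X]setTI -[X in _ `&` X]/(t @^-1` [set x | _ <= x]).
    by rewrite -set_itvcy; exact: mt.
  apply: eq_integral => w' _; rewrite /= indicE; congr EFin.
  by case: ifPn => h; [rewrite mem_set|rewrite memNset//; exact/negP].
rewrite (exponential_indep_integral (phi := fun s y => (psi s y)%:E) a0 mt0 t0E mY t0Y)//.
by apply: eq_integral => w _; exact: exponential_convolution.
Qed.

Lemma hypo_kernel_ge0 a b y : 0 < a -> a < b -> 0 <= hypo_kernel a b y.
Proof.
move=> a0 ab; rewrite /hypo_kernel; case: ifPn => // y0.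
rewrite mulr_ge0 ?invr_ge0 ?subr_ge0 ?(ltW ab)// mulr_ge0 ?(ltW a0)//.
by rewrite subr_ge0 ler_expR !mulNr lerN2 ler_pM2r// ltW.
Qed.

(** For [b >= 2 * a] the ratio [b / (b - a)] is at most 2, and the difference of exponentials is at
    most 1. The bound is uniform in [b] and [y], as dominated convergence requires. *)
Lemma hypo_kernel_le a b y : 0 < a -> 2 * a <= b -> b * hypo_kernel a b y <= 2 * a.
Proof.
move=> a0 ab.
have ab' : a < b by lra.
rewrite /hypo_kernel; case: ifPn => y0; last by rewrite mulr0 mulr_ge0// ltW.
have e1 : expR (- a * y) - expR (- b * y) <= 1.
  have : expR (- a * y) <= 1 by rewrite -expR0 ler_expR; nra.
  by have := expR_ge0 (- b * y); lra.
rewrite mulrA ler_pdivrMr ?subr_gt0// mulrA.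
apply: (@le_trans _ _ (b * a * 1)); last by nra.
by rewrite ler_pM2l// mulr_gt0// (lt_trans a0).
Qed.

Lemma measurable_hypo_kernel a b : measurable_fun setT (hypo_kernel a b).
Proof.
apply: measurable_fun_ifT => //; first exact: measurable_fun_ltr.
apply: measurable_funM => //; apply: measurable_funM => //.
by apply: measurable_funB; apply: measurableT_comp => //; exact: measurable_funM.
Qed.

(** The limit jumps at 0, where the sign of [Y n] would decide; hence [y != 0]. *)
Lemma cvg_hypo_kernel a (b Y : nat -> R) (y : R) : 0 < a ->
  b @ \oo --> +oo -> Y @ \oo --> y -> y != 0 ->
  (fun n => b n * hypo_kernel a (b n) (Y n)) @ \oo --> exponential_pdf a y.
Proof.
move=> a0 boo Yy; rewrite neq_lt => /orP[y0|y0].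
  rewrite lt0_exponential_pdf//; apply: cvg_near_cst; near=> n.
  rewrite /hypo_kernel ltNge ltW ?mulr0//=.
  by near: n; exact: (cvgr_lt y).
(* The shape matches [a * b / (b - a) = a + a * a / (b - a)]. *)
have -> : exponential_pdf a y = (a + a * a * 0) * (expR (- a * y) - 0).
  by rewrite exponential_pdfE ?ltW// mulr0 addr0 subr0.
have bigb : \forall n \near \oo, a < b n by exact: (cvgry_gt boo).
apply: (@cvg_trans _ ((fun n => (a + a * a * (b n - a)^-1) *
    (expR (- a * Y n) - expR (- b n * Y n))) @ \oo)).
  apply: near_eq_cvg; near=> n.
  have bn : a < b n by near: n.
  rewrite /hypo_kernel ifT; last by near: n; exact: (cvgr_gt y).
  by field; rewrite subr_eq0 gt_eqF.
apply: cvgM.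
  apply: cvgD; first exact: cvg_cst.
  apply: cvgMl_tmp.
  apply/(@gtr0_cvgV0 _ _ _ _ (fun n => b n - a)).
    by near=> n; rewrite subr_gt0; near: n.
  apply/cvgryPge => M; near=> n.
  rewrite lerBrDr; near: n; exact: (cvgry_ge boo).
apply: cvgB.
  apply: continuous_cvg; first exact: continuous_expR.
  exact: cvgMl_tmp.
(* Eventually [Y n > y / 2], so the second exponential is squeezed by [expR (- (y / 2 * b n))]. *)
have y20 : 0 < y / 2 by rewrite divr_gt0.
apply: (@squeeze_cvgr _ _ _ _ (fun=> 0) (fun n => expR (- (y / 2 * b n)))).
- near=> n; rewrite expR_ge0/= ler_expR mulNr lerN2.
  have Yn : y / 2 < Y n by near: n; apply: (cvgr_gt y) => //; rewrite ltr_pdivrMr//; lra.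
  have bn : a < b n by near: n.
  by rewrite mulrC ler_pM2l ?(ltW Yn)// (lt_trans a0).
- exact: cvg_cst.
- apply: (@cvg_comp _ _ _ b (fun z => expR (- (y / 2 * z))) _ (pinfty_nbhs R)) => //.
  apply: (@cvg_comp _ _ _ (fun z => y / 2 * z) (fun z => expR (- z)) _ (pinfty_nbhs R)).
    exact: gt0_cvgMry.
  exact: cvgr_expR.
Unshelve. all: by end_near. Qed.

Lemma cvg_integral_hypo_kernel (a : R) (b : nat -> R) (Y : nat -> Omega -> R)
    (y : Omega -> R) : 0 < a -> b @ \oo --> +oo ->
  (forall n, measurable_fun setT (Y n)) -> measurable_fun setT y ->
  (\forall w \ae P, (Y n w @[n --> \oo] --> y w) /\ y w != 0) ->
  (fun n => b n * fine (\int[P]_w (hypo_kernel a (b n) (Y n w))%:E)) @ \oo -->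
    fine (\int[P]_w (exponential_pdf a (y w))%:E).
Proof.
move=> a0 boo mY my Yy.
have [N _ Nb] : \forall n \near \oo, 2 * a <= b n by exact: (cvgry_ge boo).
rewrite -(cvg_shiftn N)/=.
pose f_ n w := (b (n + N)%N * hypo_kernel a (b (n + N)%N) (Y (n + N)%N w))%:E.
have bN n : 2 * a <= b (n + N)%N by apply: Nb; rewrite /= leq_addl.
have aN n : a < b (n + N)%N by have := bN n; lra.
have f0 n w : (0 <= f_ n w)%E.
  rewrite lee_fin mulr_ge0 ?hypo_kernel_ge0//.
  by rewrite (le_trans _ (bN n))// mulr_ge0// ltW.
have mk n : measurable_fun setT (fun w => (hypo_kernel a (b n) (Y n w))).
  exact: (measurableT_comp (measurable_hypo_kernel _ _)).
have [] := @dominated_convergence _ _ R P setT measurableT f_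
  (fun w => (exponential_pdf a (y w))%:E) (cst (2 * a)%:E).
- by move=> n; apply/measurable_EFinP; apply: measurable_funM => //; exact: mk.
- apply/measurable_EFinP.
  exact: (measurableT_comp (measurable_exponential_pdf _)).
- apply: filterS Yy => w [Yw yw] _.
  apply: cvg_EFin; first exact: nearW.
  rewrite /f_ /=.
  apply: (@cvg_hypo_kernel a (fun n => b (n + N)%N) (fun n => Y (n + N)%N w)) => //.
    by rewrite (cvg_shiftn N b).
  by rewrite (cvg_shiftn N (Y ^~ w)).
- by apply: finite_measure_integrable_cst.
- apply: aeW => w n _; rewrite gee0_abs//= lee_fin; exact: hypo_kernel_le.
move=> intpdf _ /= cvgI.
have fI : (\int[P]_w (exponential_pdf a (y w))%:E)%E \is a fin_num.
  exact: integrable_fin_num intpdf.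
have := cvgI; rewrite -{1}(fineK fI) => /fine_cvg; apply: cvg_trans.
apply: near_eq_cvg; apply: nearW => n /=; rewrite /f_.
have b0 : 0 < b (n + N)%N by exact: lt_trans (aN n).
under eq_integral do rewrite EFinM.
rewrite ge0_integralZl//=.
(* The factor passes through [fine] for infinite values too: a positive multiple stays infinite, and
   [fine] sends infinities to 0. *)
- case: (integral _ _ _) => [r| |] /=; rewrite ?mulr0//.
    by rewrite gt0_muley ?lte_fin.
  by rewrite gt0_muleNy ?lte_fin.
- by apply/measurable_EFinP; exact: mk.
- by move=> w _; rewrite lee_fin hypo_kernel_ge0.
- by rewrite lee_fin ltW.
Qed.

End hypoexponential.

Section tail_sums.
Context {R : realType}.

(** As [Q] vanishes at infinity, [Q x] telescopes into the sum of [q k] over [k > x]; the termwise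
    estimate of [q k - c * f k] by [e * f k] then sums up. *)
Lemma tail_sum_equiv (q f Q : nat -> R) (c : R) :
  (forall k, (0 < k)%N -> 0 < f k) -> cvgn (series f) ->
  (fun k => q k / f k) @ \oo --> c ->
  (\forall x \near \oo, Q x - Q x.+1 = q x.+1) -> Q @ \oo --> 0 ->
  (fun x => Q x / \big[+%R/0]_(x.+1 <= k <oo) f k) @ \oo --> c.
Proof.
move=> f0 cf qf Qq Q0.
have [N _ NQ] := Qq.
pose s x n := \sum_(x.+1 <= k < n) f k.
pose t x := limn (s x).
have cs x : s x @ \oo --> t x by rewrite /s /t is_cvg_series_restrict.
have tS x n : s x n <= t x.
  apply: nondecreasing_cvgn_le; last exact: cs.
  apply/nondecreasing_seqP => m; rewrite /s.
  have [xm|mx] := leqP x.+1 m; last by rewrite !big_geq// ltnW.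
  by rewrite big_nat_recr//= lerDl ltW// f0// (leq_trans _ xm).
have t_gt0 x : 0 < t x.
  by apply: lt_le_trans (tS x x.+2); rewrite /s big_nat1 f0.
have Qsum x n : (N <= x)%N -> (x <= n)%N -> Q x = \sum_(x.+1 <= k < n.+1) q k + Q n.
  move=> Nx; elim: n => [|n IH].
    by rewrite leqn0 => /eqP ->; rewrite big_geq// add0r.
  rewrite leq_eqVlt => /predU1P[->|xn]; first by rewrite big_geq// add0r.
  rewrite big_nat_recr//= -addrA IH//; congr (_ + _).
  by rewrite -NQ ?subrK//= (leq_trans Nx).
apply/cvgrPdist_le => e e0.
move/cvgrPdist_le : qf => /(_ _ e0)[K _ Kq].
near=> x.
have Nx : (N <= x)%N by near: x; exists N.
have Kx : (K <= x)%N by near: x; exists K.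
rewrite -[X in X - _](mulfK (lt0r_neq0 (t_gt0 x))) -mulrBl normrM normfV.
rewrite (gtr0_norm (t_gt0 x)) ler_pdivrMr//.
(* The estimate is made on finite sums, with the remainder [Q n] kept, and [n] is sent to infinity
   afterwards. *)
have bnd n : (x <= n)%N -> `|c * \sum_(x.+1 <= k < n.+1) f k - (Q x - Q n)| <= e * t x.
  move=> xn; rewrite (Qsum x n)// addrK mulr_sumr -sumrB.
  apply: (le_trans (ler_norm_sum _ _ _)).
  apply: (@le_trans _ _ (e * \sum_(x.+1 <= k < n.+1) f k)); last first.
    by rewrite ler_pM2l//; exact: tS.
  rewrite mulr_sumr; apply: ler_sum_nat => k /andP[xk _].
  have fk : 0 < f k by rewrite f0// (leq_ltn_trans _ xk).
  have := Kq k (leq_trans Kx (ltnW xk)); rewrite /= => h.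
  rewrite -[q k](divfK (lt0r_neq0 fk)) -mulrBl normrM (gtr0_norm fk).
  by rewrite ler_pM2r.
have lim_bnd : (fun n => `|c * s x n.+1 - (Q x - Q n)|) @ \oo -->
    `|c * t x - (Q x - 0)|.
  apply: cvg_norm; apply: cvgB.
    by apply: cvgMl_tmp; rewrite (cvg_shiftS (s x)).
  by apply: cvgB => //; exact: cvg_cst.
rewrite subr0 in lim_bnd; rewrite -(cvg_lim _ lim_bnd)//.
apply: limr_le; first by apply/cvg_ex; eexists; exact: lim_bnd.
near=> n; apply: bnd; near: n; exact: nbhs_infty_ge.
Unshelve. all: by end_near. Qed.

End tail_sums.

(** * Densities of explosion times *)

Section density_transfer.
Context {R : realType} {d : measure_display} {Omega : measurableType d}.
Variable P : probability Omega R.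
Local Notation mu := lebesgue_measure.

Lemma ae_measure_eq (E E' : set Omega) : measurable E -> measurable E' ->
  (\forall w \ae P, E w <-> E' w) -> P E = P E'.
Proof.
move=> mE mE' EE'; rewrite -[E]setIT -[E']setIT -!integral_indic//.
apply: ge0_ae_eq_integral => //.
- by apply/measurable_EFinP; exact: measurable_indic.
- by apply/measurable_EFinP; exact: measurable_indic.
- by apply: filterS EE' => w h _; rewrite !indicE;
    suff -> : (w \in E) = (w \in E') by []; apply/idP/idP; rewrite !inE => /h.
Qed.

(** A Dynkin argument from rays to Borel sets. Complements are handled by subtraction, hence the
    finite total mass; the masses agree because the rays []-oo, n]] exhaust the line. *)
Lemma integral_rays_eq (f1 f2 : R -> \bar R) :
  measurable_fun setT f1 -> measurable_fun setT f2 ->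
  (forall x, 0 <= f1 x)%E -> (forall x, 0 <= f2 x)%E ->
  (\int[mu]_x f1 x < +oo)%E ->
  (forall t : R, \int[mu]_(x in `]-oo, t]) f1 x = \int[mu]_(x in `]-oo, t]) f2 x)%E ->
  forall B : set R, measurable B -> (\int[mu]_(x in B) f1 x = \int[mu]_(x in B) f2 x)%E.
Proof.
move=> mf1 mf2 f10 f20 f1oo f12 B.
have mf1D D : measurable_fun D f1 by exact: measurable_funTS.
have mf2D D : measurable_fun D f2 by exact: measurable_funTS.
have f12T : (\int[mu]_x f1 x = \int[mu]_x f2 x)%E.
  have cov : \bigcup_n `]-oo, n%:R]%classic = [set: R].
    apply/seteqP; split=> // x _; exists (Num.truncn `|x|).+1 => //=.
    by rewrite in_itv/= ltW// (le_lt_trans (ler_norm _))// truncnS_gt.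
  have nd : nondecreasing_seq (fun n : nat => `]-oo, n%:R]%classic : set R).
    move=> m n mn; apply/subsetPset => x /=; rewrite !in_itv/= => /le_trans; apply.
    by rewrite ler_nat.
  rewrite -cov.
  have c (f : R -> \bar R) : measurable_fun setT f -> (forall x, 0 <= f x)%E ->
      (\int[mu]_(x in `]-oo, n%:R]) f x @[n --> \oo] -->
        \int[mu]_(x in \bigcup_n `]-oo, n%:R]%classic) f x)%E.
    move=> mf f0; apply: ge0_nondecreasing_set_cvg_integral => //.
    by move=> n; exact: measurable_funTS.
  rewrite -(cvg_lim _ (c f1 mf1 f10))// -(cvg_lim _ (c f2 mf2 f20))//.
  by congr (limn _); apply/funext => n.
have RE : @measurable _ R = <<s @RGenInftyO.G R >>.
  exact: RGenInftyO.measurableE.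
rewrite RE; apply: (@dynkin_induction _ R (RGenInftyO.G (R := R))
  (fun B => \int[mu]_(x in B) f1 x = \int[mu]_(x in B) f2 x)%E) => //.
- move=> _ _ [x ->] [y ->]; exists (Num.min x y).
  by apply/seteqP; split=> z /=; rewrite !in_itv/= lt_min => /andP.
- move=> _ [x ->]; have := f12 x.
  by rewrite -!integral_itv_bndo_bndc.
- move=> S mS S12.
  have add f : measurable_fun setT f -> (forall x, 0 <= f x)%E ->
      (\int[mu]_x f x = \int[mu]_(x in S) f x + \int[mu]_(x in ~` S) f x)%E.
    move=> mf f0; rewrite -(setUv S) ge0_integral_setU//.
    + exact: measurableC.
    + by rewrite setUv.
    + exact/disj_setPCl.
  have addI (x y z : \bar R) : (0 <= x)%E -> (0 <= y)%E ->
      (x + y = x + z)%E -> (x + y < +oo)%E -> y = z.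
    case: x y z => [x| |] [y| |] [z| |]//=; rewrite -?EFinD => _ _ [] //.
    by move=> /addrI ->.
  move: f12T f1oo; rewrite (add f1)// (add f2)// S12.
  by apply: addI; exact: integral_ge0.
- move=> S mS tS S12; rewrite !ge0_integral_bigcup//;
    [|exact: mf2D|exact: mf1D].
  by apply: eq_eseriesr => n _; exact: S12.
Qed.

Variables (a : R) (t0 r : Omega -> R).
Hypotheses (a0 : 0 < a) (mt0 : measurable_fun setT t0) (mr : measurable_fun setT r).
Hypothesis t0E : forall B, measurable B -> P (t0 @^-1` B) = exponential_prob a B.
Hypothesis t0r : indep_vars P t0 r.

Let G (t : R) : \bar R := (\int[P]_w (exponential_pdf a (t - r w))%:E)%E.

Let mpdf : measurable_fun setT (fun x : R * R => (exponential_pdf a (x.2 - x.1))%:E).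
Proof.
apply/measurable_EFinP; apply: (measurableT_comp (measurable_exponential_pdf a)).
exact: measurable_funB.
Qed.

Let mpdfr : measurable_fun setT
  (fun x : Omega * R => (exponential_pdf a (x.2 - r x.1))%:E).
Proof.
apply/measurable_EFinP; apply: (measurableT_comp (measurable_exponential_pdf a)).
by apply: measurable_funB => //; exact: (measurableT_comp mr).
Qed.

Let pdf0 x : (0 <= (exponential_pdf a x)%:E)%E.
Proof. by rewrite lee_fin exponential_pdf_ge0// ltW. Qed.

Let G0 t : (0 <= G t)%E.
Proof. exact: integral_ge0. Qed.

Let mG : measurable_fun setT G.
Proof.
exact: (@measurable_fun_fubini_tonelli_G _ _ Omega R R P
  (fun x => (exponential_pdf a (x.2 - r x.1))%:E)).
Qed.

(** With [r] frozen, translating the integration variable moves the shift from the indicator to the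
    exponential density; Tonelli does the rest. *)
Lemma sum_exponential_density (B : set R) : measurable B ->
  P [set w | B (r w + t0 w)] = (\int[mu]_(t in B) G t)%E.
Proof.
move=> mB.
have mI : measurable_fun setT (fun x : R => (\1_B x : R)%:E).
  by apply/measurable_EFinP; exact: measurable_indic.
have mE : measurable [set w | B (r w + t0 w)].
  rewrite -[X in measurable X]setTI.
  by apply: (measurable_funD mr mt0).
rewrite -[X in P X]setIT -integral_indic//.
rewrite (exponential_indep_integral (phi := fun s z => (\1_B (z + s))%:E) a0 mt0 t0E mr t0r)//; last first.
  by apply: (measurableT_comp mI); exact: measurable_funD.
transitivity (\int[P]_w \int[mu]_t ((\1_B t)%:E * (exponential_pdf a (t - r w)%R)%:E))%E.
  apply: eq_integral => w _.
  rewrite -[RHS](ge0_integral_shift (r w)).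
  - by apply: eq_integral => s _; rewrite addrAC subrr add0r.
  - apply: (emeasurable_funM mI); exact: (measurableT_comp mpdfr (pair1_measurable _)).
  - by move=> x; rewrite mule_ge0// lee_fin.
rewrite (@fubini_tonelli _ _ Omega (measurableTypeR R) R P mu
  (fun x => (\1_B x.2)%:E * (exponential_pdf a (x.2 - r x.1)%R)%:E)%E).
- rewrite [RHS]integral_mkcond; apply: eq_integral => t _.
  rewrite /= ge0_integralZl// ?lee_fin//; last exact: (measurableT_comp mpdfr (pair2_measurable _)).
  by rewrite epatch_indic muleC.
- apply: emeasurable_funM mpdfr; exact: (measurableT_comp mI).
- by move=> x; rewrite mule_ge0// lee_fin.
Qed.

(* [g] is determined by [is_density] only up to a null set, hence the absolute
   continuity required of [m]. *)
Lemma density_transfer (T : Omega -> \bar R) (g : R -> R) (m : Omega -> R) :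
  measurable_fun setT T -> (\forall w \ae P, T w = (r w + t0 w)%:E) ->
  is_density P T g ->
  measurable_fun setT m -> indep_vars P r m ->
  (forall N, measurable N -> mu N = 0%E -> P (m @^-1` N) = 0%E) ->
  (\int[P]_w (g (m w))%:E = \int[P]_w (exponential_pdf a (m w - r w))%:E)%E.
Proof.
move=> mT TE [mg [g0 gE]] mm rm mac.
have meg : measurable_fun setT (EFin \o g) by exact/measurable_EFinP.
have eg0 x : (0 <= (EFin \o g) x)%E by rewrite lee_fin.
have GT : (\int[mu]_x G x = 1)%E.
  by rewrite -sum_exponential_density// -[RHS](@probability_setT _ _ _ P).
have ray t : (\int[mu]_(x in `]-oo, t]) G x = \int[mu]_(x in `]-oo, t]) (EFin \o g) x)%E.
  rewrite -[RHS]gE -sum_exponential_density//.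
  apply: ae_measure_eq.
  - rewrite -[X in measurable X]setTI.
    by apply: (measurable_funD mr mt0).
  - rewrite -[X in measurable X]setTI -preimage_itvNyc.
    by apply: mT => //; exact: emeasurable_itv.
  - by apply: filterS TE => w /= ->; rewrite in_itv/= lee_fin.
have gG B : measurable B -> (\int[mu]_(x in B) G x = \int[mu]_(x in B) (EFin \o g) x)%E.
  by apply: integral_rays_eq => //; rewrite GT ltry.
have [N [mN N0 GN]] : ae_eq mu setT G (EFin \o g).
  apply: integral_ae_eq => //.
    apply/integrableP; split => //.
    by under eq_integral do rewrite gee0_abs//; rewrite GT ltry.
  by move=> E _ mE; exact: gG.
transitivity (\int[P]_w G (m w))%E.
  apply: ge0_ae_eq_integral => //.
  - exact: (measurableT_comp meg).
  - exact: (measurableT_comp mG).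
  - by move=> w _; rewrite lee_fin.
  - exists (m @^-1` N); split.
    + by rewrite -[X in measurable X]setTI; exact: mm.
    + exact: mac.
    + move=> w /= h; apply: GN => /= h'; apply: h => _; exact/esym/h'.
by rewrite (indep_integral (phi := fun x : R * R => (exponential_pdf a (x.2 - x.1))%:E) mr mm rm).
Qed.

End density_transfer.

(** * The urn under the law of the birth processes *)

Section model.
Context {R : realType} {d : measure_display} {Omega : measurableType d}.
Variables (P : probability Omega R) (A : nat).
Variables (F : 'I_A -> nat -> R) (X0 : 'I_A -> nat) (tau : 'I_A -> nat -> Omega -> R).
Hypothesis F0 : forall j k, (0 < k)%N -> 0 < F j k.
Hypothesis X00 : forall j, (0 < X0 j)%N.
Hypothesis mtau : forall j k, (X0 j <= k)%N -> measurable_fun setT (tau j k).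
Hypothesis tauE : forall j k, (X0 j <= k)%N -> forall B, measurable B ->
  P (tau j k @^-1` B) = exponential_prob (F j k) B.
Local Notation Idx := (fun jk : 'I_A * nat => (X0 jk.1 <= jk.2)%N).
Local Notation X := (fun jk : 'I_A * nat => tau jk.1 jk.2).
Hypothesis indtau : mutually_independent P Idx X.

Let mX (u : 'I_A * nat) : Idx u -> measurable_fun setT (X u).
Proof. exact: mtau. Qed.

Let F0' j k : (X0 j <= k)%N -> 0 < F j k.
Proof. by move=> Xk; rewrite F0// (leq_trans (X00 j)). Qed.

Lemma ae_forall_ord (Q : 'I_A -> Omega -> Prop) :
  (forall j, \forall w \ae P, Q j w) -> \forall w \ae P, forall j, Q j w.
Proof.
move=> h; suff : \forall w \ae P, forall n (nA : (n < A)%N), Q (Ordinal nA) w.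
  apply: filterS => w hw j.
  by rewrite (_ : j = Ordinal (ltn_ord j)) ?hw//; exact/val_inj.
apply: ae_foralln => n; have [nA|nA] := pselect (n < A)%N.
  by apply: filterS (h (Ordinal nA)) => w hw nA'; rewrite (bool_irrelevance nA' nA).
by apply: aeW => w nA'; case: (nA nA').
Qed.

Lemma ae_not (E : set Omega) : measurable E -> P E = 0%E ->
  \forall w \ae P, ~ E w.
Proof. by move=> mE E0; exists E; split => // w /contrapT. Qed.

Lemma ae_tau_gt0 : \forall w \ae P, forall j k, (X0 j <= k)%N -> 0 < tau j k w.
Proof.
apply: ae_forall_ord => j; apply: ae_foralln => k.
have [Xk|Xk] := pselect (X0 j <= k)%N; last by apply: aeW => w /Xk.
have := exponential_gt0 (tauE Xk).
move=> /(ae_not (measurable_set_ler (mtau Xk) (measurable_cst (0 : R)))).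
by apply: filterS => w /= /negP; rewrite -ltNge.
Qed.

(** The series of sojourn times has finite mean, at most four times the sum of the inverse rates,
    since a sojourn of rate [F j k] has mean at most [4 / F j k]. *)
Lemma ae_explosion_lty j : (\sum_(1 <= k <oo) ((F j k)^-1)%:E < +oo)%E ->
  \forall w \ae P, (explosion_time X0 tau j w < +oo)%E.
Proof.
move=> sF.
(* Positive parts make the integrands nonnegative everywhere, and indices below [X0 j], where
   nothing is known of [tau], are set to zero. *)
pose f k w := if (X0 j <= k)%N then (Num.max (tau j k w) 0)%:E else 0%E.
have f0 k w : (0 <= f k w)%E.
  by rewrite /f; case: ifP => // _; rewrite lee_fin le_max lexx orbT.
have mf k : measurable_fun setT (f k).
  rewrite /f; have [Xk|_] := boolP (X0 j <= k)%N; last exact: measurable_cst.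
  apply/measurable_EFinP; apply: (measurableT_comp measurable_max0); exact: mtau.
have If k : (\int[P]_w f k w <= if (0 < k)%N then (4 * (F j k)^-1)%:E else 0)%E.
  rewrite /f; have [Xk|Xk] := boolP (X0 j <= k)%N.
    rewrite (leq_trans (X00 j) Xk).
    by have := exponential_mean (F0' Xk) (mtau Xk) (tauE Xk).
  rewrite integral0; case: ifP => // k0.
  by rewrite lee_fin mulr_ge0// invr_ge0 ltW// F0.
have Isum : (\int[P]_w (\sum_(k <oo) f k w) < +oo)%E.
  rewrite integral_nneseries//.
  apply: (@le_lt_trans _ _ (4%:E * \sum_(1 <= k <oo) ((F j k)^-1)%:E)%E); last first.
    by rewrite lte_mul_pinfty.
  apply: lime_le.
    by apply: is_cvg_nneseries => k _ _; exact: integral_ge0.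
  apply: nearW => n; rewrite big_mkord.
  apply: (@le_trans _ _ (4%:E * \sum_(1 <= k < n) ((F j k)^-1)%:E)%E); last first.
    rewrite lee_pmul2l//; apply: nneseries_lim_ge => k k0 _.
    by rewrite lee_fin invr_ge0 ltW// F0.
  rewrite -(big_mkord xpredT (fun k => \int[P]_w f k w)%E).
  apply: (@le_trans _ _ (\sum_(0 <= k < n) if (0 < k)%N then (4 * (F j k)^-1)%:E else 0)%E).
    exact: lee_sum.
  case: n => [|n]; first by rewrite !big_geq// mule0.
  rewrite big_ltn// add0e sumEFin -EFinM mulr_sumr -sumEFin.
  by rewrite big_nat_cond [leRHS]big_nat_cond; apply: lee_sum => k /andP[/andP[-> _] _].
have fin : P.-integrable setT (fun w => \sum_(k <oo) f k w)%E.
  apply/integrableP; split.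
    exact: ge0_emeasurable_sum.
  under eq_integral do rewrite gee0_abs ?nneseries_ge0//.
  exact: Isum.
have := integrable_ae measurableT fin; apply: filterS2 ae_tau_gt0 => w tau0 /(_ I).
rewrite ge0_fin_numE ?nneseries_ge0//; apply: le_lt_trans.
rewrite explosion_time_sup//; apply: ge_ereal_sup => _ [k _ <-].
apply: le_trans (nneseries_lim_ge k.+1 _) => //.
rewrite /partial_time -sumEFin.
rewrite [leRHS](@big_cat_nat _ _ _ (minn (X0 j) k.+1))/= ?geq_minr//.
have [Xk|kX] := leqP (X0 j) k.+1; last by rewrite big_geq ?(ltnW kX)// adde_ge0// sume_ge0.
rewrite -[leLHS]add0e leeD ?sume_ge0//.
rewrite big_nat_cond [leRHS]big_nat_cond; apply: lee_sum => l /andP[/andP[Xl _] _].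
by rewrite /f Xl lee_fin le_max lexx.
Qed.

(** Raising the starting state by one encodes the remainder after the first sojourn, so R needs no
    definition of its own. *)
Lemma explosion_time_recl j (Y : 'I_A -> nat) w :
  (forall k, (Y j <= k)%N -> 0 < tau j k w) ->
  explosion_time Y tau j w =
    ((tau j (Y j) w)%:E + explosion_time (fun j => (Y j).+1) tau j w)%E.
Proof.
move=> tau0; rewrite /explosion_time (nneseries_split _ 1%N).
  by rewrite addn1 big_nat1.
by move=> k Yk; rewrite lee_fin ltW// tau0.
Qed.

Lemma explosion_time_fin j (Y : 'I_A -> nat) w :
  (forall k, (Y j <= k)%N -> 0 < tau j k w) -> (explosion_time Y tau j w < +oo)%E ->
  explosion_time Y tau j w =
    (fine (explosion_time (fun j => (Y j).+1) tau j w) + tau j (Y j) w)%:E.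
Proof.
move=> tau0; rewrite explosion_time_recl// addrC EFinD.
have : (0 <= explosion_time (fun j => (Y j).+1) tau j w)%E.
  by apply: nneseries_ge0 => k Yk _; rewrite lee_fin ltW// tau0// ltnW.
by case: explosion_time.
Qed.

(** One sojourn time against any function of all the others: every independence between a sojourn
    time and a composite variable below is an instance. *)
Lemma tau_indep (u : 'I_A * nat) d' (T : measurableType d') (Z : Omega -> T) :
  Idx u -> measurable_fun (setT : set (blockType X [set v | Idx v /\ v != u])) Z ->
  indep_vars P (X u) Z.
Proof.
move=> Iu mZ; apply: (block_indep mX indtau _ _ _ _ mZ (K := [set u])).
- by move=> v ->.
- by move=> v [].
- by apply/seteqP; split=> // v [-> [_]]; rewrite eqxx.
- exact: block_measurable.
Qed.

Lemma block_explosion_time K (Y : 'I_A -> nat) j :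
  (forall k, (Y j <= k)%N -> K (j, k)) ->
  measurable_fun (setT : set (blockType X K)) (explosion_time Y tau j).
Proof.
move=> YK; apply: (@measurable_explosion_time _ (blockType X K) R A Y tau j).
by move=> k Yk; exact: (@block_measurable _ _ _ _ X _ (j, k) (YK k Yk)).
Qed.

Lemma block_partial_time K (Y : 'I_A -> nat) j k :
  (forall l, (Y j <= l <= k)%N -> K (j, l)) ->
  measurable_fun (setT : set (blockType X K)) (partial_time Y tau j k).
Proof.
move=> YK; apply: (@measurable_partial_time _ (blockType X K) R A Y tau j).
by move=> l Yl; exact: (@block_measurable _ _ _ _ X _ (j, l) (YK l Yl)).
Qed.

Lemma block_min_other K i : (forall j k, j != i -> (X0 j <= k)%N -> K (j, k)) ->
  measurable_fun (setT : set (blockType X K)) (min_other_explosion X0 tau i).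
Proof.
move=> YK; apply: (@measurable_min_other_explosion _ (blockType X K) R A X0 tau i).
by move=> j k ji Xk; exact: (@block_measurable _ _ _ _ X _ (j, k) (YK j k ji Xk)).
Qed.

Lemma tail_indep (j : 'I_A) : indep_vars P (tau j (X0 j))
  (fine \o explosion_time (fun j => (X0 j).+1) tau j).
Proof.
apply: (@tau_indep (j, X0 j)); first exact: leqnn.
apply: measurableT_comp; first exact: fine_measurable.
apply: block_explosion_time => k Xk; split => /=; first exact: ltnW.
by apply/negP => /eqP[] kE; rewrite kE ltnn in Xk.
Qed.

Variable i : 'I_A.
Local Notation M := (min_other_explosion X0 tau i).
Local Notation m := (fine \o M).
Hypothesis Moo : \forall w \ae P, (M w < +oo)%E.

Lemma ae_M : \forall w \ae P, M w = (m w)%:E.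
Proof.
apply: filterS2 ae_tau_gt0 Moo => w tau0 Mw /=; rewrite fineK// ge0_fin_numE//.
have [j _ <-] := min_other_explosion_attained Mw.
exact: ltW (jump_time_lt tau0 0 j).
Qed.

Let measurable_M : measurable_fun setT M.
Proof. by apply: measurable_min_other_explosion => j k _; exact: mtau. Qed.

Let measurable_m : measurable_fun setT m.
Proof. by apply: measurableT_comp => //; exact: fine_measurable. Qed.

Lemma ae_null (E : set Omega) : measurable E -> (\forall w \ae P, ~ E w) -> P E = 0%E.
Proof.
move=> mE nE; rewrite -[RHS](measure0 P); apply: ae_measure_eq => //.
by apply: filterS nE => w.
Qed.

Let measurable_tail (Y : 'I_A -> nat) j : (forall j, (X0 j <= Y j)%N) ->
  measurable_fun setT (fine \o explosion_time Y tau j).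
Proof.
move=> XY; apply: measurableT_comp; first exact: fine_measurable.
by apply: measurable_explosion_time => k Yk; apply: mtau; exact: leq_trans Yk.
Qed.

(** The minimum is attained by some finite explosion time, a first sojourn plus an independent
    remainder. Each such sum avoids [N] almost surely, and there are finitely many agents. *)
Lemma min_other_ac (N : set R) : measurable N -> lebesgue_measure N = 0%E ->
  P (m @^-1` N) = 0%E.
Proof.
move=> mN N0.
apply: ae_null; first by rewrite -[X in measurable X]setTI; exact: measurable_m.
have h j : \forall w \ae P,
    ~ N (fine (explosion_time (fun j => (X0 j).+1) tau j w) + tau j (X0 j) w).
  have mt := measurable_tail j (fun j => leqnSn (X0 j)).
  apply: ae_not.
    rewrite -[X in measurable X]setTI.
    by apply: (measurable_funD mt (mtau (leqnn _))).
  exact: (exponential_indep_ac (F0' (leqnn _)) (mtau (leqnn _)) (tauE (leqnn _))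
    mt (tail_indep j) mN N0).
apply: filterS3 ae_tau_gt0 Moo (ae_forall_ord h) => w tau0 Mw hw.
have [j _ Tj] := min_other_explosion_attained Mw.
by rewrite /= -Tj explosion_time_fin ?Tj// => [/hw|k]; last exact: tau0.
Qed.

(** Equality would force the sojourn time at [Y i] to equal [m - T'], which is independent of it.
    The start [X0] excludes ties T_i = M; the start [X0 + 1] excludes R = M. *)
Lemma ae_explosion_neq (Y : 'I_A -> nat) : (forall j, (X0 j <= Y j)%N) ->
  \forall w \ae P, explosion_time Y tau i w <> M w.
Proof.
move=> XY; pose T' := fine \o explosion_time (fun j => (Y j).+1) tau i.
have mT' : measurable_fun setT T' by apply: measurable_tail => j; rewrite ltnW// ltnS.
have mZ : measurable_fun setT (fun w => m w - T' w) by exact: measurable_funB.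
have ind : indep_vars P (tau i (Y i)) (fun w => m w - T' w).
  apply: (@tau_indep (i, Y i)); first exact: XY.
  apply: measurable_funB; apply: measurableT_comp; try exact: fine_measurable.
    apply: block_min_other => j k ji Xk; split => //=.
    by apply: contra ji => /eqP[-> _].
  apply: block_explosion_time => k Yk; split; first by rewrite /= (leq_trans (XY i))// ltnW.
  by apply/negP => /eqP[kE]; rewrite kE ltnn in Yk.
have := exponential_indep_neq (F0' (XY i)) (mtau (XY i)) (tauE (XY i)) mZ ind.
move=> /ae_not h.
have {}h : \forall w \ae P, tau i (Y i) w <> m w - T' w.
  apply: h; rewrite (_ : [set w | _] = [set w | tau i (Y i) w <= m w - T' w] `&`
      [set w | m w - T' w <= tau i (Y i) w]).
    by apply: measurableI; apply: measurable_set_ler => //; exact: mtau.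
  by apply/seteqP; split=> w /= => [->|[h1 h2]]; [|apply/eqP; rewrite eq_le h1].
apply: filterS3 ae_tau_gt0 Moo h => w tau0 Mw hw TM.
apply: hw; rewrite /T' /= -TM explosion_time_fin ?TM//=.
  by rewrite addrC addKr.
by move=> k Yk; apply: tau0; exact: leq_trans Yk.
Qed.

(** * Local asymptotics of the limit of X_i *)

Local Notation Y0 := (fun j => (X0 j).+1).
Local Notation r := (fine \o explosion_time Y0 tau i).
Local Notation s := (partial_time Y0 tau i).
Local Notation S := (partial_time X0 tau i).
Local Notation a := (F i (X0 i)).

Let XY0 j : (X0 j <= (X0 j).+1)%N. Proof. exact: leqnSn. Qed.

Let measurable_s x : measurable_fun setT (s x).
Proof. by apply: measurable_partial_time => l /andP[Xl _]; apply: mtau; exact: ltnW. Qed.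

Let measurable_S x : measurable_fun setT (S x).
Proof. by apply: measurable_partial_time => l /andP[Xl _]; exact: mtau. Qed.

Lemma partial_time_recl x w : (X0 i <= x)%N -> S x w = tau i (X0 i) w + s x w.
Proof. by move=> Xx; rewrite /partial_time big_ltn. Qed.

(* Almost surely, this is the event that the limit of X_i is x. *)
Definition between x := [set w | ((S x.-1 w)%:E < M w)%E /\ (M w <= (S x w)%:E)%E].

Lemma measurable_between x : measurable (between x).
Proof.
have mS y : measurable_fun setT (EFin \o S y) by exact/measurable_EFinP.
rewrite (_ : between x = [set w | ((S x.-1 w)%:E < M w)%E] `&`
   [set w | (M w <= (S x w)%:E)%E]) //; apply: measurableI.
  by have := measurable_lte measurableT (mS x.-1) measurable_M; rewrite setTI.
by have := measurable_lee measurableT measurable_M (mS x); rewrite setTI.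
Qed.

(** The condition [X0 i < x] makes the sojourns at [X0 i] and [x] distinct variables; [m - s x.-1]
    involves neither of them. *)
Lemma prob_between x : (X0 i < x)%N -> a != F i x ->
  P (between x) = (\int[P]_w (hypo_kernel a (F i x) (m w - s x.-1 w))%:E)%E.
Proof.
case: x => // x; rewrite ltnS => Xx ax /=.
have Iu : (X0 i <= X0 i)%N by [].
have Ix : (X0 i <= x.+1)%N by exact: leqW.
have block K : (forall j k, j != i -> (X0 j <= k)%N -> K (j, k)) ->
    (forall l, (X0 i < l <= x)%N -> K (i, l)) ->
    measurable_fun (setT : set (blockType X K)) (fun w => m w - s x w).
  move=> K1 K2; apply: measurable_funB; last exact: block_partial_time.
  by apply: measurableT_comp; [exact: fine_measurable|exact: block_min_other].
have neqK (j : 'I_A) (k l : nat) : j != i -> (j, k) != (i, l).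
  by apply: contra => /eqP[-> _].
have mY : measurable_fun setT (fun w => m w - s x w) by exact: measurable_funB.
rewrite -(hypoexponential_between (F0' Iu) (F0' Ix) ax (mtau Iu) (mtau Ix) mY
  (tauE Iu) (tauE Ix)).
- apply: ae_measure_eq; first exact: measurable_between.
    rewrite (_ : [set w | _] = [set w | tau i (X0 i) w < m w - s x w] `&`
      [set w | m w - s x w <= tau i (X0 i) w + tau i x.+1 w]).
      apply: measurableI; first exact: (measurable_set_ltr (mtau Iu)).
      exact: (measurable_set_ler mY (measurable_funD (mtau Iu) (mtau Ix))).
    by apply/seteqP; split=> w /= => [/andP[]|[-> ->]].
  apply: filterS ae_M => w Mw; rewrite /between /= Mw lte_fin lee_fin.
  rewrite !partial_time_recl// partial_timeS// ltrBrDr lerBlDr.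
  by rewrite addrA addrAC; split=> [[-> ->]|/andP[]].
- apply: (@tau_indep (i, X0 i)) => //; apply: block => [j k ji Xk|l /andP[Xl _]].
    by split => //; exact: neqK.
  split; first exact: ltnW.
  by apply/negP => /eqP[lE]; rewrite lE ltnn in Xl.
- apply: (@tau_indep (i, x.+1)) => //; apply: measurable_funB.
    apply: block => [j k ji Xk|l /andP[Xl lx]].
      by split => //; exact: neqK.
    split; first exact: ltnW.
    by apply/negP => /eqP[lE]; rewrite lE ltnn in lx.
  apply: (@block_measurable _ _ _ _ X _ (i, X0 i)); split=> //=.
  by apply/negP => /eqP[lE]; rewrite lE ltnn in Xx.
Qed.

Lemma ae_tail : \forall w \ae P, (explosion_time X0 tau i w < +oo)%E ->
  (fun x => s x.-1 w) @ \oo --> r w.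
Proof.
apply: filterS ae_tau_gt0 => w tau0 Too.
have tau0' j k : ((X0 j).+1 <= k)%N -> 0 < tau j k w by move=> /ltnW; exact: tau0.
rewrite -(cvg_shiftS (fun x => s x.-1 w)).
apply: (@fine_cvg _ _ _ _ (fun x => (s x w)%:E)).
have -> : (r w)%:E = explosion_time Y0 tau i w.
  rewrite fineK// ge0_fin_numE; last first.
    by apply: nneseries_ge0 => k Yk _; rewrite lee_fin ltW// tau0'.
  apply: le_lt_trans Too; rewrite (explosion_time_recl (Y := X0)); last exact: tau0.
  by rewrite leeDr// lee_fin ltW// tau0.
rewrite explosion_time_sup//; apply: ereal_nondecreasing_cvgn => k l kl.
by rewrite lee_fin partial_time_homo.
Qed.

Hypothesis Too : \forall w \ae P, (explosion_time X0 tau i w < +oo)%E.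
Local Notation T := (explosion_time X0 tau i).
Local Notation c := (\int[P]_w (exponential_pdf a (m w - r w))%:E)%E.

Let a_gt0 : 0 < a. Proof. exact: F0' (leqnn _). Qed.

Let measurable_T : measurable_fun setT T.
Proof. by apply: measurable_explosion_time => k; exact: mtau. Qed.

Let measurable_r : measurable_fun setT r.
Proof. exact: measurable_tail. Qed.

Let measurable_mr : measurable_fun setT (fun w => m w - r w).
Proof. exact: measurable_funB. Qed.

Lemma ae_m_neq_r : \forall w \ae P, m w - r w != 0.
Proof.
apply: filterS3 ae_tau_gt0 (filterI ae_M Too) (ae_explosion_neq XY0) => w tau0 [Mw Tw].
apply: contra_not_neq => /eqP; rewrite subr_eq0 => /eqP mr.
rewrite Mw mr fineK// ge0_fin_numE; last first.
  by apply: nneseries_ge0 => k Yk _; rewrite lee_fin ltW// tau0// ltnW.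
apply: le_lt_trans Tw; rewrite [leRHS]explosion_time_recl; last exact: tau0.
by rewrite leeDr// lee_fin ltW// tau0.
Qed.

Lemma cvg_prob_between : F i @ \oo --> +oo ->
  (fun x => F i x * fine (P (between x))) @ \oo --> fine c.
Proof.
move=> Foo.
have Yy : \forall w \ae P, (m w - s n.-1 w @[n --> \oo] --> m w - r w) /\
    m w - r w != 0.
  apply: filterS3 ae_m_neq_r Too ae_tail => w mr Tw /(_ Tw) sr; split=> //.
  by apply: cvgB => //; exact: cvg_cst.
have := cvg_integral_hypo_kernel a_gt0 Foo
  (fun n => measurable_funB measurable_m (measurable_s n.-1)) measurable_mr Yy.
apply: cvg_trans; apply: near_eq_cvg; near=> x.
rewrite prob_between//; last by rewrite lt_eqF//; near: x; exact: (cvgry_gt Foo).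
by near: x; exact: nbhs_infty_gt.
Unshelve. all: by end_near. Qed.

Let mpdf : measurable_fun setT (fun w => (exponential_pdf a (m w - r w))%:E).
Proof.
apply/measurable_EFinP.
exact: (measurableT_comp (measurable_exponential_pdf a)).
Qed.

Let pdf0 w : (0 <= (exponential_pdf a (m w - r w))%:E)%E.
Proof. by rewrite lee_fin exponential_pdf_ge0// ltW. Qed.

Lemma limit_constant_fin : c \is a fin_num.
Proof.
rewrite ge0_fin_numE; last exact: integral_ge0.
apply: (@le_lt_trans _ _ (\int[P]_w a%:E)%E).
  by apply: ge0_le_integral => // w _; rewrite lee_fin exponential_pdf_le.
by rewrite integral_cst//= probability_setT mule1 ltry.
Qed.

Lemma prob_tail_lt : exists n : nat, P [set w | r w < n%:R] != 0%E.
Proof.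
apply: contrapT => /forallNP h.
have h0 n : \forall w \ae P, ~ (r w < n%:R).
  apply: ae_not; first exact: measurable_set_ltr.
  by apply/eqP/negPn/negP; exact: h.
have : P setT = 0%E.
  apply: ae_null => //; apply: filterS (ae_foralln h0) => w hw _.
  apply: (hw (Num.truncn `|r w|).+1); exact: le_lt_trans (ler_norm _) (truncnS_gt _).
by rewrite probability_setT => -[] /eqP; rewrite oner_eq0.
Qed.

(* The minimum exceeds [n] as soon as the first sojourn time of every other
   agent does, an event of positive probability by independence. *)
Lemma prob_min_other_ge (n : nat) : P [set w | n%:R <= m w] != 0%E.
Proof.
apply/eqP => h.
have mge : measurable [set w | n%:R <= m w] by exact: measurable_set_ler.
pose Js := [seq (j, X0 j) | j <- enum 'I_A & j != i].
pose B (u : 'I_A * nat) : set R := `[n%:R, +oo[%classic.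
have uJ : uniq Js by rewrite map_inj_uniq => [|j k []//]; exact/filter_uniq/enum_uniq.
have JI u : u \in Js -> Idx u by move=> /mapP[j _ ->] /=.
have := indtau uJ JI (fun u => measurable_itv _ : measurable (B u)).
have -> : P (\big[setI/setT]_(u <- Js) (X u @^-1` B u)) = 0%E.
  apply: ae_null.
    rewrite big_seq; apply: bigsetI_measurable => u /JI Iu.
    by rewrite -[X in measurable X]setTI; apply: mtau => //; exact: measurable_itv.
  apply: filterS3 ae_tau_gt0 (filterI ae_M Moo) (ae_not mge h) => w tau0 [Mw Mwoo].
  apply: contra_not; rewrite -bigcap_seq => tn /=.
  have [j ji Tj] := min_other_explosion_attained Mwoo.
  rewrite -lee_fin -Mw -Tj explosion_time_recl; last exact: tau0.
  have : (X (j, X0 j) @^-1` B (j, X0 j)) w.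
    by apply: tn; apply: (map_f (fun j => (j, X0 j))); rewrite mem_filter ji mem_enum.
  rewrite /B /= in_itv/= andbT => tnj.
  rewrite -[leLHS]adde0 leeD ?lee_fin//.
  by apply: nneseries_ge0 => k Yk _; rewrite lee_fin ltW// tau0// ltnW.
move=> /esym/eqP; rewrite big_seq.
apply/negP; rewrite gt_eqF//.
elim/big_ind: _ => // [x y x0 y0|u /JI Iu]; first exact: mule_gt0.
rewrite tauE//; last exact: measurable_itv.
by rewrite exponential_prob_tail ?F0'// lte_fin expR_gt0.
Qed.

Lemma tail_min_other_indep : indep_vars P r m.
Proof.
apply: (block_indep mX indtau (K := [set u | u.1 = i /\ (X0 i < u.2)%N])
  (L := [set u | u.1 != i /\ Idx u])).
- by move=> [j k] /= [-> /ltnW].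
- by move=> u [].
- by apply/seteqP; split=> // u /= [[-> _] []]; rewrite eqxx.
- apply: measurableT_comp; first exact: fine_measurable.
  by apply: block_explosion_time => k.
- apply: measurableT_comp; first exact: fine_measurable.
  by apply: block_min_other.
Qed.

(** The exponential density is positive on [[0, +oo[], so a zero constant would give [m < r] almost
    surely. Yet [r < n <= m] has positive probability, by independence of the two. *)
Lemma limit_constant_gt0 : 0 < fine c.
Proof.
rewrite fine_gt0// -ge0_fin_numE ?limit_constant_fin ?andbT; last exact: integral_ge0.
rewrite lt0e integral_ge0// andbT; apply/eqP => c0.
have mr0 : \forall w \ae P, m w - r w < 0.
  have : (\int[P]_w `|(exponential_pdf a (m w - r w))%:E| = 0)%E.
    by rewrite -c0; apply: eq_integral => w _; rewrite gee0_abs.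
  move/(ae_eq_integral_abs _ measurableT mpdf); apply: filterS => w /(_ I) /= [].
  apply: contra_eqT; rewrite -leNgt => mr.
  by rewrite exponential_pdfE// mulf_neq0// gt_eqF// expR_gt0.
have [n rn] := prob_tail_lt.
have := tail_min_other_indep (measurable_itv `]-oo, n%:R[) (measurable_itv `[n%:R, +oo[).
have -> : P (r @^-1` `]-oo, n%:R[ `&` m @^-1` `[n%:R, +oo[) = 0%E.
  apply: ae_null.
    apply: measurableI; rewrite -[X in measurable X]setTI.
      exact: measurable_r.
    exact: measurable_m.
  apply: filterS mr0 => w; rewrite /= !in_itv/= andbT subr_lt0 => mr [rn' nm].
  by have := lt_trans (le_lt_trans nm mr) rn'; rewrite ltxx.
move=> /esym/eqP; rewrite mule_eq0 => /orP[].
  by rewrite (_ : _ @^-1` _ = [set w | r w < n%:R]) ?(negbTE rn)//;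
    apply/seteqP; split=> w /=; rewrite in_itv.
by rewrite (_ : _ @^-1` _ = [set w | n%:R <= m w]) ?(negbTE (prob_min_other_ge n))//;
  apply/seteqP; split=> w /=; rewrite in_itv/= andbT.
Qed.

(* Almost surely, this is the event that the limit of X_i exceeds x and i is not
   the strong monopolist. *)
Definition survive x := [set w | ((S x w)%:E < M w)%E /\ (M w <= T w)%E].

Lemma measurable_survive x : measurable (survive x).
Proof.
have mS y : measurable_fun setT (EFin \o S y) by exact/measurable_EFinP.
rewrite (_ : survive x = [set w | ((S x w)%:E < M w)%E] `&`
   [set w | (M w <= T w)%E]) //; apply: measurableI.
  by have := measurable_lte measurableT (mS x) measurable_M; rewrite setTI.
by have := measurable_lee measurableT measurable_M measurable_T; rewrite setTI.
Qed.

(** Surviving level [x] splits according to whether [M] comes before or after the exit from [x.+1];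
    in the first case [M <= T] holds automatically. *)
Lemma survive_diff x :
  fine (P (survive x)) - fine (P (survive x.+1)) = fine (P (between x.+1)).
Proof.
have fP E : measurable E -> P E \is a fin_num by move=> mE; exact: fin_num_measure.
have mB := measurable_between x.+1; have mS1 := measurable_survive x.+1.
suff -> : P (survive x) = (P (between x.+1) + P (survive x.+1))%E.
  by rewrite fineD ?fP// addrK.
rewrite -measureU//; last first.
  apply/seteqP; split=> // w [[_ MS]] [SM _].
  by have := le_lt_trans MS SM; rewrite ltxx.
apply: ae_measure_eq; [exact: measurable_survive|exact: measurableU|].
apply: filterS ae_tau_gt0 => w tau0; rewrite /survive /between /=.
split=> [[SM MT]|[[SM MS]|[SM MT]]].
- by have [MS|SM'] := leP (M w) (S x.+1 w)%:E; [left|right].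
- split=> //; apply: (le_trans MS); apply: ltW.
  exact: partial_time_lt_explosion.
- by split=> //; apply: le_lt_trans SM; rewrite lee_fin partial_time_homo.
Qed.

Lemma ae_T_neq_M : \forall w \ae P, T w <> M w.
Proof. exact: ae_explosion_neq. Qed.

(** Off ties, [M <= T] means [M < T], and the partial sums eventually exceed [M]: almost every path
    leaves the events. *)
Lemma survive_cvg0 : (fun x => fine (P (survive x))) @ \oo --> 0.
Proof.
have mI x : measurable_fun setT (fun w => (\1_(survive x) w : R)%:E).
  by apply/measurable_EFinP; exact/measurable_indic/measurable_survive.
have [] := @dominated_convergence _ _ R P setT measurableT
  (fun x w => (\1_(survive x) w)%:E) (cst 0%E) (cst 1%E).
- exact: mI.
- exact: measurable_cst.
- apply: filterS2 ae_tau_gt0 ae_T_neq_M => w tau0 TM _; apply: cvg_near_cst.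
  have [MT|MT] := leP (M w) (T w); last first.
    by near=> x; rewrite indicE memNset// => -[_]; rewrite leNgt MT.
  have {}MT : (M w < T w)%E by rewrite lt_neqAle MT andbT; apply/eqP => /esym.
  have [k Xk Mk] := lt_explosion_time tau0 MT.
  near=> x; rewrite indicE memNset// => -[SM _].
  have := lt_trans SM Mk; rewrite lte_fin ltNge => /negP; apply.
  by apply: partial_time_homo => //; near: x; exact: nbhs_infty_ge.
- exact: finite_measure_integrable_cst.
- apply: aeW => w n _; rewrite gee0_abs ?lee_fin//= indicE.
move=> _ _ /=; rewrite integral0 => h.
apply: (@fine_cvg _ _ _ _ (fun x => P (survive x))).
apply: cvg_trans h; apply: near_eq_cvg; apply: nearW => x /=.
by rewrite integral_indic// ?setIT//; exact: measurable_survive.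
Unshelve. all: by end_near. Qed.

End model.

Section rates.
Context {R : realType}.

Lemma summable_inv_rate (f : nat -> R) : (forall k, (0 < k)%N -> 0 < f k) ->
  (\sum_(1 <= k <oo) ((f k)^-1)%:E < +oo)%E ->
  cvgn (series (fun k => (f k)^-1)) /\ f @ \oo --> +oo.
Proof.
move=> f0 sf.
have cf : cvgn (series (fun k => (f k)^-1)).
  (* The sum starts at 1 because the sign of [f 0] is unknown. *)
  rewrite -(is_cvg_series_restrict 1); apply: nondecreasing_is_cvgn.
    apply/nondecreasing_seqP => n /=.
    have [n0|] := leqP 1 n; last by rewrite ltnS leqn0 => /eqP ->; rewrite !big_geq.
    by rewrite big_nat_recr//= lerDl invr_ge0 ltW// f0.
  have s0 k : (1 <= k)%N -> true -> (0 <= ((f k)^-1)%:E)%E.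
    by move=> k0 _; rewrite lee_fin invr_ge0 ltW// f0.
  exists (fine (\sum_(1 <= k <oo) ((f k)^-1)%:E)%E) => _ [n _ <-] /=.
  rewrite -lee_fin fineK; last by rewrite ge0_fin_numE// nneseries_ge0.
  by rewrite -sumEFin; exact: nneseries_lim_ge.
split=> //; apply/gtr0_cvgV0; last exact: (cvg_series_cvg_0 cf).
by near=> n; apply: f0; near: n; exact: nbhs_infty_gt.
Unshelve. all: by end_near. Qed.

End rates.

Theorem theorem2 (R : realType) (d : measure_display) (Omega : measurableType d)
  (P : probability Omega R) (A : nat) (F : 'I_A -> nat -> R) (X0 : 'I_A -> nat)
  (tau : 'I_A -> nat -> Omega -> R) (i : 'I_A) (g : R -> R) :
  (2 <= A)%N ->
  (forall j k, (0 < k)%N -> 0 < F j k) ->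
  (forall j, (0 < X0 j)%N) ->
  (forall j k, (X0 j <= k)%N -> measurable_fun setT (tau j k)) ->
  (forall j k, (X0 j <= k)%N -> forall B, measurable B ->
      P (tau j k @^-1` B) = exponential_prob (F j k) B) ->
  mutually_independent P (fun jk : 'I_A * nat => (X0 jk.1 <= jk.2)%N)
    (fun jk => tau jk.1 jk.2) ->
  (\sum_(1 <= k <oo) ((F i k)^-1)%:E < +oo)%E ->
  (exists j, j != i /\ (\sum_(1 <= k <oo) ((F j k)^-1)%:E < +oo)%E) ->
  is_density P (explosion_time X0 tau i) g ->
  let Eg := fine (\int[P]_w (g (fine (min_other_explosion X0 tau i w)))%:E) in
  let sMonc := ~` strong_monopoly X0 tau i in
  asymp_equiv
    (fun x : nat => fine (P [set w | urn_limit X0 tau i w = (x%:R)%:E]))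
    (fun x : nat => Eg / F i x)
  /\
  asymp_equiv
    (fun x : nat => fine (P ([set w | ((x%:R)%:E < urn_limit X0 tau i w)%E] `&` sMonc))
                    / fine (P sMonc))
    (fun x : nat => Eg / fine (P [set w | (min_other_explosion X0 tau i w
                                            < explosion_time X0 tau i w)%E])
                    * \big[+%R/0]_(x.+1 <= k <oo) (F i k)^-1).
Proof.
move=> A2 F0 X00 mtau tauE indtau sFi [j1 [j1i sFj1]] gden Eg sMonc.
set M := min_other_explosion X0 tau i; set T := explosion_time X0 tau i.
have [cF Foo] := summable_inv_rate (F0 i) sFi.
have Too := ae_explosion_lty F0 X00 mtau tauE sFi.
have Moo : \forall w \ae P, (M w < +oo)%E.
  apply: filterS (ae_explosion_lty F0 X00 mtau tauE sFj1) => w; apply: le_lt_trans.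
  exact: bigmin_le_cond.
have tau0 := ae_tau_gt0 mtau tauE.
pose r := fine \o explosion_time (fun j => (X0 j).+1) tau i.
pose a := F i (X0 i).
have a0 : 0 < a by exact: F0.
pose c := (\int[P]_w (exponential_pdf a (fine (M w) - r w))%:E)%E.
have c0 : 0 < fine c by exact: (limit_constant_gt0 F0 X00 mtau tauE indtau Moo).
have mM : measurable_fun setT M.
  by apply: measurable_min_other_explosion => j k _; exact: mtau.
have mT : measurable_fun setT T by apply: measurable_explosion_time => k; exact: mtau.
have mm : measurable_fun setT (fine \o M).
  by apply: measurableT_comp => //; exact: fine_measurable.
have mr : measurable_fun setT r.
  apply: measurableT_comp; first exact: fine_measurable.
  by apply: measurable_explosion_time => k Xk; apply: mtau; exact: ltnW.
(* Here [g] disappears: the rest of the proof works with the explicit constant [c]. *)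
have EgE : Eg = fine c.
  congr fine; apply: (density_transfer a0 (mtau i (X0 i) (leqnn _)) mr
      (tauE i (X0 i) (leqnn _)) (tail_indep mtau indtau i) mT _ gden mm).
  - apply: filterS2 tau0 Too => w t0 Tw.
    by rewrite /T explosion_time_fin//; exact: t0.
  - exact: (tail_min_other_indep mtau indtau i).
  - by move=> N mN N0; exact: (min_other_ac F0 X00 mtau tauE indtau Moo mN N0).
pose q x := fine (P (between X0 tau i x)).
pose Q x := fine (P (survive X0 tau i x)).
have Fq : (fun x => F i x * q x) @ \oo --> fine c.
  exact: (cvg_prob_between F0 X00 mtau tauE indtau Moo Too).
have mL : measurable_fun setT (urn_limit X0 tau i) by exact: measurable_urn_limit.
have msM : measurable sMonc by apply: measurableC; exact: measurable_strong_monopoly.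
have mgt (x : nat) : measurable [set w | (x%:R%:E < urn_limit X0 tau i w)%E].
  rewrite -[X in measurable X]setTI -preimage_itvoy.
  by apply: mL => //; exact: emeasurable_itv.
(* An extended natural equals [x.+1] exactly when it exceeds [x] but not [x.+1], so two instances of
   [urn_limit_gtE] determine the event. *)
have Lq x : (X0 i < x)%N -> P [set w | urn_limit X0 tau i w = (x%:R)%:E] =
    P (between X0 tau i x).
  case: x => // x; rewrite ltnS => Xx.
  apply: ae_measure_eq.
  - rewrite -[X in measurable X]setTI.
    exact: (mL measurableT _ (emeasurable_set1 _)).
  - exact: measurable_between.
  - apply: filterS tau0 => w t0; rewrite /between /=.
    have L1 := urn_limit_gtE t0 Xx.
    have L2 := urn_limit_gtE t0 (leqW Xx).
    have natL := urn_limit_natbar X0 tau i w.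
    split=> [Lx|[/L1 + MS]].
      split; first by apply/L1; rewrite Lx lte_fin ltr_nat.
      by rewrite leNgt; apply/negP => /L2; rewrite Lx ltxx.
    rewrite natbar_ltE// => xL; apply/eqP; rewrite eq_le xL andbT leNgt.
    by apply/negP => /L2; rewrite ltNge MS.
have sME : \forall w \ae P, sMonc w <-> (M w <= T w)%E.
  apply: filterS2 tau0 Moo => w t0 Mw.
  exact: not_strong_monopolyE.
have PsM : P sMonc = P [set w | (M w < T w)%E].
  apply: ae_measure_eq => //.
    by have := measurable_lte measurableT mM mT; rewrite setTI.
  apply: filterS2 sME (ae_T_neq_M F0 X00 mtau tauE indtau Moo) => w sMw TM.
  split=> [/sMw MT|/= MT]; last by apply/sMw; exact: ltW.
  by rewrite /= lt_neqAle MT andbT; apply/eqP => /esym.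
have PQ x : (X0 i <= x)%N ->
    P ([set w | ((x%:R)%:E < urn_limit X0 tau i w)%E] `&` sMonc) =
    P (survive X0 tau i x).
  move=> Xx; apply: ae_measure_eq.
  - exact: measurableI.
  - exact: measurable_survive.
  - apply: filterS2 tau0 sME => w t0 sMw; rewrite /survive /=.
    by have L := urn_limit_gtE t0 Xx; split=> [[/L ? /sMw]|[/L ? /sMw]].
(* Positivity of the limit [c] makes [q] positive at large levels, so some survival event, contained
   in [sMonc] up to a null set, has positive probability. *)
have pi0 : 0 < fine (P sMonc).
  have [x Xx qx] : exists2 x, (X0 i <= x)%N & 0 < Q x.
    have [N _ Nq] : \forall x \near \oo, 0 < F i x * q x.
      exact: (cvgr_gt (fine c)).
    exists (maxn N (X0 i)); first exact: leq_maxr.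
    have : 0 < q (maxn N (X0 i)).+1.
      by have := Nq (maxn N (X0 i)).+1 (leqW (leq_maxl _ _)); rewrite /= pmulr_rgt0// F0.
    have := survive_diff mtau tauE i (maxn N (X0 i)); rewrite /q => <-.
    by rewrite subr_gt0; apply: le_lt_trans; rewrite fine_ge0.
  apply: lt_le_trans qx _; rewrite /Q -PQ//; apply: fine_le.
  - by apply: fin_num_measure; exact: measurableI.
  - exact: fin_num_measure.
  - by apply: le_measure; rewrite ?inE//; exact: measurableI.
split; rewrite /asymp_equiv EgE.
  apply: (@cvg_trans _ ((fun x => F i x * q x / fine c) @ \oo)); last first.
    by rewrite -(divff (lt0r_neq0 c0)); exact: cvgMr_tmp.
  apply: near_eq_cvg; near=> x.
  rewrite Lq; last by near: x; exact: nbhs_infty_gt.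
  by rewrite invf_div mulrA [F i x * _]mulrC.
pose t x := \big[+%R/0]_(x.+1 <= k <oo) (F i k)^-1.
have Qt : (fun x => Q x / t x) @ \oo --> fine c.
  apply: (tail_sum_equiv (q := q) _ cF).
  - by move=> k k0; rewrite invr_gt0 F0.
  - by under eq_fun do rewrite invrK mulrC.
  - by apply: nearW => x; exact: (survive_diff mtau tauE i x).
  - exact: (survive_cvg0 F0 X00 mtau tauE indtau Moo).
rewrite -PsM.
apply: (@cvg_trans _ ((fun x => Q x / t x / fine c) @ \oo)); last first.
  by rewrite -(divff (lt0r_neq0 c0)); exact: cvgMr_tmp.
apply: near_eq_cvg; near=> x.
rewrite PQ; last by near: x; exact: nbhs_infty_ge.
rewrite -/(Q x) -/(t x) !invfM !invrK.
(* The probability of [sMonc] divides both the conditional probability and the claimed constant, and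
   cancels. *)
rewrite [RHS](_ : _ = Q x * (t x)^-1 * (fine c)^-1 * ((fine (P sMonc))^-1 * fine (P sMonc))).
  by rewrite mulVf ?mulr1// gt_eqF.
by rewrite -!mulrA; congr (_ * _); rewrite !mulrA; ring.
Unshelve. all: by end_near. Qed.
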